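(* Let $H$ be a complex Hilbert space and let $L\in GL_{S}^{+}(H)$ be a positive isomorphism. Let $\Theta=\{a+ib\in\mathbb{C}: a>0\}$ and let $\gamma:\Theta\to\mathbb{C}$ be the holomorphic function $\gamma(\lambda)=|\lambda|^{1/2}e^{\frac{i\,\mathrm{Arg}\,\lambda}{2}}$, where $\mathrm{Arg}\,\lambda$ is the principal argument of $\lambda$. Then there exists a closed path $\Gamma\subseteq\Theta$, with $\sigma(L)\subseteq\mathring{\Gamma}$, such that $$L^{1/2}=\gamma(L)=-\frac{1}{2\pi i}\int_{\Gamma}\gamma(\lambda)(L-\lambda I)^{-1}\,d\lambda,$$ where $L^{1/2}$ denotes the nonnegative square root of $L$.
   Context: $L(H)$ is the Banach space of bounded linear operators $H\to H$, and $I$ is the identity. An operator is an isomorphism if it is bijective with bounded inverse. A self-adjoint operator $L\in L(H)$ is called nonnegative if $\langle Lx,x\rangle\ge 0$ for all $x\in H$, and positive if $\langle Lx,x\rangle>0$ for all $x\in H$ with $\Vert x\Vert=1$. $GL_{S}^{+}(H)$ denotes the set of $L\in L(H)$ that are self-adjoint, positive and isomorphisms. Every nonnegative $L\in L(H)$ has a unique nonnegative square root, i.e. a unique nonnegative $R\in L(H)$ with $R^{2}=L$; it is denoted $L^{1/2}$. The spectrum $\sigma(L)$ is the set of $\lambda\in\mathbb{C}$ such that $L-\lambda I$ is not an isomorphism. ''Closed path'' means a closed, simple, positively oriented (counterclockwise), rectifiable path in $\mathbb{C}$; $\mathring{\Gamma}$ is its interior, i.e. the bounded region of $\mathbb{C}$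 enclosed by $\Gamma$. The integral of a continuous $L(H)$-valued function along $\Gamma$ is the limit in operator norm of Riemann sums $\sum_i(\lambda_i-\lambda_{i-1})f(\zeta_i)$ over partitions of $\Gamma$ with mesh tending to $0$, where $\zeta_i$ lies on the arc of $\Gamma$ from $\lambda_{i-1}$ to $\lambda_i$. For a holomorphic function $f:\Delta\to\mathbb{C}$ on an open set $\Delta\supseteq\sigma(L)$, the operator $f(L)\in L(H)$ is defined by $f(L)=-\frac{1}{2\pi i}\int_{\Gamma}f(\lambda)(L-\lambda I)^{-1}d\lambda$, for a closed path $\Gamma$ which together with its interior is contained in $\Delta$ and has $\sigma(L)\subseteq\mathring{\Gamma}$. *)

(* Defs.v *)
From HB Require Import structures.
From mathcomp Require Import all_boot all_order all_algebra.
From mathcomp Require Import complex.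
From mathcomp Require Import all_classical all_reals all_analysis.

Set Implicit Arguments.
Unset Strict Implicit.
Unset Printing Implicit Defensive.

Import Order.TTheory GRing.Theory Num.Theory.
Import numFieldNormedType.Exports.

Local Open Scope classical_set_scope.
Local Open Scope complex_scope.
Local Open Scope ring_scope.

(* The complex plane is [R[i]^o]: the type [R[i]] with the topology and the
   normed module structure over itself given by the modulus.  The modulus
   [`|z|] and norms in an [R[i]]-module take (real) values in [R[i]];
   [rnorm] is the same norm with values in [R]. *)
Definition rnorm (R : realType) (V : normedModType R[i]) (x : V) : R :=
  complex.Re `|x|.

Section Operators.
Variables (R : realType) (H : normedModType R[i]).
Implicit Types (A B : H -> H).

Definition bounded_op A : Prop :=
  linear A /\ exists M : R, forall x, rnorm (A x) <= M * rnorm x.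

Definition op_norm A : \bar R :=
  ereal_sup [set (rnorm (A x))%:E | x in [set x : H | rnorm x <= 1]].

Definition is_inverse_op A B : Prop :=
  [/\ bounded_op B, cancel A B & cancel B A].

Definition isomorphism_op A : Prop :=
  bounded_op A /\ exists B, is_inverse_op A B.

(* Equal to [0] when [A] has no bounded inverse. *)
Definition inv_op A : H -> H := xget 0 [set B | is_inverse_op A B].

Definition spectrum A : set R[i]^o :=
  [set l | ~ isomorphism_op (A - l *: idfun)].

Definition resolvent A (l : R[i]^o) : H -> H := inv_op (A - l *: idfun).

Section InnerProduct.
Variable dot : {dot H for (@Num.conj R[i])}.

Definition self_adjoint A : Prop := forall x y, dot (A x) y = dot x (A y).

Definition nonneg_op A : Prop :=
  [/\ bounded_op A, self_adjoint A & forall x, 0 <= dot (A x) x].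

Definition positive_op A : Prop :=
  [/\ bounded_op A, self_adjoint A & forall x, `|x| = 1 -> 0 < dot (A x) x].

Definition GLSplus A : Prop := positive_op A /\ isomorphism_op A.

Definition sqrt_op A : H -> H :=
  xget 0 [set S | nonneg_op S /\ S \o S = A].

End InnerProduct.
End Operators.

Section PathIntegral.
Variable R : realType.
Implicit Types (c : R -> R[i]^o) (t : seq R) (s : nat -> R).

(* A partition [0 = t_0 < t_1 < ... < t_n = 1] is given by the list
   [t = [:: t_1; ...; t_n]], as in [itv_partition]; [s i] is the tag of the
   interval from [t_i] to [t_(i+1)], i.e. [nth 0 (0 :: t) i] to [nth 0 t i]. *)
Definition tagged_partition t s (d : R) : Prop :=
  itv_partition 0 1 t /\
  forall i, (i < size t)%N ->
    nth 0 (0 :: t) i <= s i <= nth 0 t i /\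
    nth 0 t i - nth 0 (0 :: t) i < d.

Definition riemann_sum (V : lmodType R[i]) c (f : R[i]^o -> V) t s : V :=
  \sum_(i < size t) (c (nth 0 t i) - c (nth 0 (0 :: t) i)) *: f (c (s i)).

(* [J] is the limit, with respect to the norm [N] on [V], of the Riemann sums
   of [f] along [c] as the mesh tends to [0]. *)
Definition is_path_integral (V : lmodType R[i]) (N : V -> \bar R)
    c (f : R[i]^o -> V) (J : V) : Prop :=
  forall e : R, 0 < e -> exists2 d : R, 0 < d &
    forall t s, tagged_partition t s d ->
      (N (riemann_sum c f t s - J)%R < e%:E)%E.

Definition is_complex_integral c (f : R[i]^o -> R[i]^o) (J : R[i]^o) : Prop :=
  is_path_integral (fun z : R[i]^o => (rnorm z)%:E) c f J.

Definition is_op_integral (H : normedModType R[i]) c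
    (f : R[i]^o -> (H -> H)) (J : H -> H) : Prop :=
  is_path_integral (@op_norm R H) c f J.

Definition path_image c : set R[i]^o := c @` `[0, 1].

Definition path_interior c : set R[i]^o :=
  [set z | ~ path_image c z /\
           bounded_set (connected_component (~` path_image c) z)].

Definition rectifiable c : Prop :=
  exists M : R, forall t, itv_partition 0 1 t ->
    \sum_(i < size t) rnorm (c (nth 0 t i) - c (nth 0 (0 :: t) i)) <= M.

Definition two_pi_i : R[i] := (pi *+ 2)%:C * 'i.

Definition winding_number_eq c (z : R[i]^o) (n : int) : Prop :=
  is_complex_integral c (fun w => (w - z)^-1) (two_pi_i * n%:~R).

Definition closed_path c : Prop :=
  [/\ {within `[0, 1], continuous c},
      c 0 = c 1,
      {in `[0, 1[ &, injective c},
      rectifiable c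
    & forall z, path_interior c z -> winding_number_eq c z 1].

Definition holomorphic_on (D : set R[i]^o) (f : R[i]^o -> R[i]^o) : Prop :=
  forall z, D z -> derivable f z 1.

End PathIntegral.

Section FunctionalCalculus.
Variables (R : realType) (H : normedModType R[i]).

(* [T = -1/(2 pi i) * integral along c of f(l) (L - l I)^-1 dl]; the
   convergence of the integral is part of the assertion. *)
Definition is_cauchy_integral (f : R[i]^o -> R[i]^o) (L : H -> H)
    (c : R -> R[i]^o) (T : H -> H) : Prop :=
  exists2 J : H -> H,
    is_op_integral c (fun l => (f l : R[i]) *: resolvent L l) J &
    T = - (two_pi_i R)^-1 *: J.

(* [T = f(L)], for a function [f] which is holomorphic on [D]; the values of
   [f] outside of [D] are irrelevant. *)
Definition is_holomorphic_calculus (D : set R[i]^o) (f : R[i]^o -> R[i]^o)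
    (L T : H -> H) : Prop :=
  [/\ open D, holomorphic_on D f, spectrum L `<=` D &
      exists c : R -> R[i]^o,
        [/\ closed_path c, path_image c `|` path_interior c `<=` D,
            spectrum L `<=` path_interior c & is_cauchy_integral f L c T]].

End FunctionalCalculus.

Section SquareRoot.
Variable R : realType.

Definition expi (x : R) : R[i] := cos x +i* sin x.

(* The principal argument, in the interval from [- pi] (excluded) to [pi]
   (included); unspecified at [0]. *)
Definition Arg (z : R[i]^o) : R :=
  get [set x : R | - pi < x <= pi /\ z = (rnorm z)%:C * expi x].

Definition gamma (z : R[i]^o) : R[i]^o :=
  (Num.sqrt (rnorm z))%:C * expi (Arg z / 2).

Definition Theta : set R[i]^o := [set z | 0 < complex.Re z].

End SquareRoot.

(* Main.v *)
Require Import Defs.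
From HB Require Import structures.
From mathcomp Require Import all_boot all_order all_algebra.
From mathcomp Require Import complex.
From mathcomp Require Import all_classical all_reals all_analysis.
From mathcomp Require Import ring lra.
Import Order.TTheory GRing.Theory Num.Theory.
Import numFieldNormedType.Exports.
Local Open Scope classical_set_scope.
Local Open Scope ring_scope.

Set Implicit Arguments.
Unset Strict Implicit.
Unset Printing Implicit Defensive.

(** Write [B = 1 - L / a] and [mu = 1 - l / a] for a constant [a] that bounds
    [L], so that [L - l = a (mu - B)].  Positivity and invertibility of [L] make [B]
    a strict contraction, [|B x| <= q |x|] with [q < 1] ([GLSplus_contraction]).
    The path is the circle [|mu| = rho] with [q < rho < 1]: the Neumann series in
    [B] converges on and outside of it, so that it encloses the spectrum, and it
    lies in the right half-plane since [rho < 1].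

    The square root of [1 - X] is approached by [1 - y_n], where the polynomials
    [y_n] are defined by [y_0 = 0] and [y_(n+1) = (X + y_n ^ 2) / 2].  When the norm
    of [X] is at most [rho], one has [|y_n| <= s] with [s = 1 - sqrt (1 - rho)],
    and [y_(n+1) - y_n] decreases like [s ^ n]; the proof is the same for the
    scalar [mu] and for the operator [B].
    - At [mu], the limit times [sqrt a] is the root of [l] with positive real
      part, which is [gamma l], uniformly on the circle ([gamma_approx]).
    - At [B], the limit [P] exists in norm, is self-adjoint, satisfies
      [P ^ 2 = 1 - B], is within [s < 1] of the identity, hence coercive, and
      commutes with all that commutes with [B].  So [sqrt a * P] is a nonnegative
      root of [L], and it is the only one: for another root [S], the vector
      [y = S x - sqrt a * P x] makes two nonnegative numbers [<S y, y>] and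
      [sqrt a * <P y, y>] have sum 0 ([sqrt_op_unique]).

    It remains to integrate [p(mu) (L - l)^-1] for a polynomial [p].  The Neumann
    series writes the resolvent as a sum of multiples of [mu ^- (k + 1)],
    uniformly on the circle ([contraction_resolvent]), and all the powers of [mu]
    have primitives along the circle, periodic except for [mu ^-1]; so the
    integral is [- 2 pi i p(B)] ([circle_integral_resolvent]).  Passing to the
    limit in [p = sqrt a (1 - y_n)] gives the theorem.

    The integrals are handled through their Riemann sums, which are linear in the
    integrand, are bounded by the length of the path times a uniform norm
    ([path_integral_lim]), and telescope up to a small error when there is
    a primitive ([path_integral_primitive]).  The same geometric series gives the
    winding number 1 of the circle about all points of its disc; that the disc
    is the interior follows from the connectedness of intervals. *)

(** * Real-valued norms *)

Section RealNorm.
Context {R : realType}.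
Local Open Scope complex_scope.
Local Open Scope ring_scope.

Lemma realC_eq0 (x : R) : (x%:C == 0 :> R[i]) = (x == 0).
Proof. exact: (inj_eq (@complexI R) x 0). Qed.

(** Radii of neighbourhoods in modules over [R[i]] are complex numbers. *)
Lemma gt0_realC (e : R[i]) : 0 < e -> exists2 d : R, 0 < d & e = d%:C.
Proof.
move=> e0; have eE : e = (complex.Re e)%:C by rewrite RRe_real// gtr0_real.
by exists (complex.Re e); rewrite // -ltcR -eE.
Qed.

Section Module.
Context {V : normedModType R[i]}.
Implicit Types (x y : V) (s : R[i]).

Lemma normE x : `|x| = (rnorm x)%:C.
Proof. by rewrite /rnorm RRe_real// ger0_real. Qed.

Lemma rnorm_ge0 x : 0 <= rnorm x.
Proof. by rewrite -lecR -normE normr_ge0. Qed.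

Lemma rnorm_eq0 x : (rnorm x == 0) = (x == 0).
Proof. by rewrite -(inj_eq (@complexI R)) -normE normr_eq0. Qed.

Lemma rnorm0 : rnorm (0 : V) = 0.
Proof. by apply/eqP; rewrite rnorm_eq0. Qed.

Lemma rnorm_gt0 x : (0 < rnorm x) = (x != 0).
Proof. by rewrite lt_def rnorm_eq0 rnorm_ge0 andbT. Qed.

Lemma rnormN x : rnorm (- x) = rnorm x.
Proof. by rewrite /rnorm normrN. Qed.

Lemma rnormB x y : rnorm (x - y) = rnorm (y - x).
Proof. by rewrite -rnormN opprB. Qed.

Lemma rnormD x y : rnorm (x + y) <= rnorm x + rnorm y.
Proof. by rewrite -lecR rmorphD/= -!normE ler_normD. Qed.

Lemma rnorm_le_sub x y : rnorm x <= rnorm y + rnorm (x - y).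
Proof. by rewrite -{1}(subrKC y x) rnormD. Qed.

Lemma rnormDB z x y : rnorm (x - y) <= rnorm (x - z) + rnorm (z - y).
Proof. by rewrite -(subrKA z) rnormD. Qed.

Lemma rnorm_sum (I : Type) (r : seq I) (P : pred I) (F : I -> V) :
  rnorm (\sum_(i <- r | P i) F i) <= \sum_(i <- r | P i) rnorm (F i).
Proof.
elim/big_ind2 : _ => // [|x a y b xa yb]; first by rewrite rnorm0.
exact: le_trans (rnormD _ _) (lerD xa yb).
Qed.

Lemma rnormZ s x : rnorm (s *: x) = rnorm (s : R[i]^o) * rnorm x.
Proof.
by apply: (@complexI R); rewrite rmorphM/= -!normE -normrZ.
Qed.

End Module.

Section Scalar.
Implicit Types z w : R[i]^o.

Lemma rnormM z w : rnorm (z * w : R[i]^o) = rnorm z * rnorm w.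
Proof. exact: (rnormZ z w). Qed.

Lemma rnorm1 : rnorm (1 : R[i]^o) = 1.
Proof. by rewrite /rnorm normr1. Qed.

Lemma rnormX z n : rnorm (z ^+ n : R[i]^o) = rnorm z ^+ n.
Proof. by elim: n => [|n IH]; rewrite ?rnorm1// !exprS rnormM IH. Qed.

Lemma rnormV z : rnorm (z^-1 : R[i]^o) = (rnorm z)^-1.
Proof.
by apply: (@complexI R); rewrite fmorphV/= -!normE normfV.
Qed.

Lemma rnormR (x : R) : rnorm (x%:C : R[i]^o) = `|x|.
Proof. by rewrite /rnorm normc_def/= expr0n/= addr0 sqrtr_sqr. Qed.

Lemma rnorm_nat n : rnorm (n%:R : R[i]^o) = n%:R.
Proof. by rewrite -(rmorph_nat (real_complex R)) rnormR normr_nat. Qed.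

Lemma rnormi : rnorm ('i%C : R[i]^o) = 1.
Proof. by rewrite /rnorm normc_def/= expr0n/= add0r expr1n sqrtr1. Qed.

Lemma Re_le_rnorm z : `|complex.Re z| <= rnorm z.
Proof. by rewrite -lecR -normE normc_ge_Re. Qed.

Lemma rnorm_le_ReIm z : rnorm z <= `|complex.Re z| + `|complex.Im z|.
Proof.
rewrite {1}[z]complexE; apply: le_trans (rnormD _ _) _.
by rewrite rnormM rnormi mul1r !rnormR.
Qed.

Lemma sqr_rnorm z : rnorm z ^+ 2 = complex.Re z ^+ 2 + complex.Im z ^+ 2.
Proof.
by apply: (@complexI R); rewrite rmorphXn/= -normE -add_Re2_Im2.
Qed.

End Scalar.
End RealNorm.

(** * Riemann sums along a path *)

Section PathIntegrals.
Context {R : realType}.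
Local Open Scope complex_scope.
Local Open Scope ring_scope.

(** Both the modulus of complex numbers and the operator norm, which may be
    infinite on arbitrary maps, satisfy these rules; they are phrased with
    finite bounds so that no infinite value is ever added. *)
Record is_ext_norm (V : lmodType R[i]) (N : V -> \bar R) : Prop := {
  ext_norm0 : (N 0%R <= 0)%E;
  ext_normD : forall x y (a b : R), (N x <= a%:E)%E -> (N y <= b%:E)%E ->
    (N (x + y)%R <= (a + b)%:E)%E;
  ext_normZ : forall (s : R[i]) x (a : R), (N x <= a%:E)%E ->
    (N (s *: x)%R <= (rnorm (s : R[i]^o) * a)%:E)%E
}.

Lemma rnorm_is_ext_norm :
  is_ext_norm (fun z : R[i]^o => (rnorm z)%:E).
Proof.
split=> [|x y a b|s x a]; rewrite ?rnorm0// !lee_fin.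
- by move=> xa yb; exact: le_trans (rnormD _ _) (lerD xa yb).
- by move=> xa; rewrite rnormZ ler_wpM2l// rnorm_ge0.
Qed.

Lemma partition_pt t i : itv_partition (0 : R) 1 t -> (i < size t)%N ->
  [/\ 0 <= nth 0 (0 :: t) i, nth 0 t i <= 1 & nth 0 (0 :: t) i < nth 0 t i].
Proof.
(* the facts about partitions of [0, 1] that are used have 1 as default value *)
move=> pt it; have [p _] := pt; split.
- rewrite (set_nth_default 1) ?(itv_partition_nth_ge _ pt)//=; exact: ltnW.
- have := @itv_partition_nth_le _ _ 0 1 t i.+1 it pt.
  by rewrite (set_nth_default 0).
- by move/(pathP 0) : p; exact.
Qed.

Lemma partition_telescope (V : zmodType) (F : R -> V) t :
  itv_partition (0 : R) 1 t ->
  \sum_(i < size t) (F (nth 0 t i) - F (nth 0 (0 :: t) i)) = F 1 - F 0.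
Proof.
move=> pt.
rewrite -(big_mkord xpredT (fun i => F (nth 0 t i) - F (nth 0 (0 :: t) i))).
rewrite (@telescope_sumr _ 0%N (size t) (fun i => F (nth 0 (0 :: t) i)))//.
by rewrite (itv_partition_nth_size 0 pt).
Qed.

Lemma tagged_partition_pt t s (d : R) i : tagged_partition t s d ->
  (i < size t)%N -> 0 <= s i <= 1.
Proof.
move=> [pt H] it; have [/andP[a b] _] := H i it.
have [c e _] := partition_pt pt it.
by rewrite (le_trans c a) (le_trans b e).
Qed.

Section ExtNorm.
Context {V : lmodType R[i]} {N : V -> \bar R}.
Hypothesis HN : is_ext_norm N.
Implicit Types (c : R -> R[i]^o) (f g : R[i]^o -> V) (J K : V).

Lemma ext_norm_sum (I : Type) (r : seq I) (F : I -> V) (a : I -> R) :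
  (forall i, (N (F i) <= (a i)%:E)%E) ->
  (N (\sum_(i <- r) F i)%R <= (\sum_(i <- r) a i)%:E)%E.
Proof.
move=> Fa; elim/big_ind2 : _ => //; first exact: ext_norm0.
by move=> x a1 y b1; exact: ext_normD.
Qed.

Lemma path_integralP c f J :
  is_path_integral N c f J <->
  forall e : R, 0 < e -> exists2 d : R, 0 < d &
    forall t s, tagged_partition t s d ->
      (N (riemann_sum c f t s - J)%R <= e%:E)%E.
Proof.
split=> H e e0.
- by have [d d0 Hd] := H e e0; exists d => // t s /Hd/ltW.
- have [d d0 Hd] := H (e / 2) (divr_gt0 e0 (ltr0Sn R 1)).
  exists d => // t s /Hd /le_lt_trans; apply.
  by rewrite lte_fin ltr_pdivrMr// ltr_pMr// ltr1n.
Qed.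

Lemma tagged_partition_le t s (d d' : R) : d <= d' ->
  tagged_partition t s d -> tagged_partition t s d'.
Proof.
move=> dd' [pt H]; split=> // i it; have [? h] := H i it.
by split=> //; exact: lt_le_trans h dd'.
Qed.

Lemma path_integralD c f g J K :
  is_path_integral N c f J -> is_path_integral N c g K ->
  is_path_integral N c (fun z => f z + g z) (J + K).
Proof.
move=> fJ gK; apply/path_integralP => e e0.
have e2 : 0 < e / 2 by rewrite divr_gt0.
have [d d0 Hd] := (path_integralP c f J).1 fJ _ e2.
have [d' d'0 Hd'] := (path_integralP c g K).1 gK _ e2.
exists (Num.min d d'); first by rewrite lt_min d0 d'0.
move=> t s ts.
have -> : riemann_sum c (fun z => f z + g z) t s - (J + K) =
    (riemann_sum c f t s - J) + (riemann_sum c g t s - K).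
  rewrite /riemann_sum opprD addrACA -big_split/=.
  by congr (_ + _); apply: eq_bigr => i _; rewrite scalerDr.
rewrite [e]splitr; apply: (ext_normD HN).
- by apply: Hd; apply: tagged_partition_le ts; rewrite ge_min lexx.
- by apply: Hd'; apply: tagged_partition_le ts; rewrite ge_min lexx orbT.
Qed.

Lemma path_integralZ c f J (k : R[i]) :
  is_path_integral N c f J ->
  is_path_integral N c (fun z => k *: f z) (k *: J).
Proof.
move=> fJ; apply/path_integralP => e e0.
have k1 : 0 < rnorm (k : R[i]^o) + 1 by rewrite ltr_pwDr// rnorm_ge0.
have [d d0 Hd] := (path_integralP c f J).1 fJ _ (divr_gt0 e0 k1).
exists d => // t s /Hd H.
have -> : riemann_sum c (fun z => k *: f z) t s - k *: J =
    k *: (riemann_sum c f t s - J).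
  rewrite scalerBr; congr (_ - _); rewrite /riemann_sum scaler_sumr.
  by apply: eq_bigr => i _; rewrite !scalerA mulrC.
apply: le_trans (ext_normZ HN k H) _.
by rewrite lee_fin mulrCA ger_pMr// ler_pdivrMr// mul1r lerDl.
Qed.

Lemma path_integral_scale c (phi : R[i]^o -> R[i]^o) (k : R[i]^o) v (a : R) :
  (N v <= a%:E)%E -> is_complex_integral c phi k ->
  is_path_integral N c (fun z => (phi z : R[i]) *: v) ((k : R[i]) *: v).
Proof.
move=> va phik; apply/path_integralP => e e0.
have a1 : 0 < Num.max a 0 + 1 by rewrite ltr_pwDr// le_max lexx orbT.
have [d d0 Hd] := phik _ (divr_gt0 e0 a1).
exists d => // t s /Hd/ltW; rewrite lee_fin => H.
have -> : riemann_sum c (fun z => (phi z : R[i]) *: v) t s - (k : R[i]) *: v =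
    (riemann_sum c phi t s - k : R[i]) *: v.
  rewrite scalerBl; congr (_ - _); rewrite /riemann_sum scaler_suml.
  by apply: eq_bigr => i _; rewrite scalerA.
apply: le_trans (ext_normZ HN _ va) _; rewrite lee_fin.
have ha : a <= Num.max a 0 + 1 by rewrite ler_wpDr// le_max lexx.
apply: le_trans (ler_wpM2l (rnorm_ge0 _) ha) _.
by rewrite -ler_pdivlMr.
Qed.

Lemma path_integral0 c : is_path_integral N c (fun=> 0) 0.
Proof.
apply/path_integralP => e e0; exists 1 => // t s _.
rewrite /riemann_sum big1 ?subr0 => [|i _]; last by rewrite scaler0.
by apply: le_trans (ext_norm0 HN) _; rewrite lee_fin ltW.
Qed.

Lemma path_integral_sum c (n : nat) (f : nat -> R[i]^o -> V) (J : nat -> V) :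
  (forall i, is_path_integral N c (f i) (J i)) ->
  is_path_integral N c (fun z => \sum_(i < n) f i z) (\sum_(i < n) J i).
Proof.
move=> fJ; elim: n => [|n IH].
  rewrite big_ord0; have := path_integral0 c; congr is_path_integral.
  by apply/funext => z; rewrite big_ord0.
rewrite big_ord_recr/=; have := path_integralD IH (fJ n).
congr is_path_integral.
by apply/funext => z; rewrite big_ord_recr.
Qed.

(** Whatever the partition, the Riemann sum of [f - g] is at most the length of
    the path times a uniform bound of [f - g]. *)
Lemma path_integral_lim c f J (l : R) :
  (forall t, itv_partition 0 1 t ->
    \sum_(i < size t) rnorm (c (nth 0 t i) - c (nth 0 (0 :: t) i)) <= l) ->
  (forall e : R, 0 < e -> exists g K,
    [/\ is_path_integral N c g K, (N (K - J)%R <= e%:E)%E &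
     forall x : R, 0 <= x <= 1 -> (N (f (c x) - g (c x))%R <= e%:E)%E]) ->
  is_path_integral N c f J.
Proof.
move=> cl H; apply/path_integralP => e e0.
have l0 : 0 <= l.
  apply: le_trans (cl [:: 1] (itv_partition1 ltr01)).
  by rewrite sumr_ge0// => i _; exact: rnorm_ge0.
have l2 : 0 < l + 1 + 1 by rewrite !ltr_wpDl// addr_ge0.
(* [l] shares of the error for [f - g], one for [g] and one for [K - J] *)
pose e' := e / (l + 1 + 1); have e'0 : 0 < e' by rewrite divr_gt0.
have [g [K [gK KJ fg]]] := H e' e'0.
have [d d0 Hd] := (path_integralP c g K).1 gK _ e'0.
exists d => // t s ts.
have -> : riemann_sum c f t s - J =
    \sum_(i < size t) (c (nth 0 t i) - c (nth 0 (0 :: t) i) : R[i]) *: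
       (f (c (s i)) - g (c (s i))) + (riemann_sum c g t s - K) + (K - J).
  rewrite -addrA subrKA addrA; congr (_ - J); rewrite /riemann_sum -big_split/=.
  by apply: eq_bigr => i _; rewrite -scalerDr subrK.
have -> : e = l * e' + e' + e'.
  by rewrite -{2 3}(mul1r e') -!mulrDl mulrC divfK// gt_eqF.
apply: (ext_normD HN) KJ; apply: (ext_normD HN) (Hd _ _ ts).
apply: (@le_trans _ _ (\sum_(i < size t)
    rnorm (c (nth 0 t i) - c (nth 0 (0 :: t) i)) * e')%:E).
  by apply: ext_norm_sum => i; apply: (ext_normZ HN); apply: fg;
    exact: tagged_partition_pt ts _.
by rewrite lee_fin -mulr_suml (ler_wpM2r (ltW e'0))//; apply: cl; have [] := ts.
Qed.

End ExtNorm.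

(** The increments of [G] telescope.  Errors that are quadratic in the lengths of
    the intervals add up to at most a multiple of the mesh, the sum of these
    lengths being 1. *)
Lemma path_integral_primitive (c : R -> R[i]^o) (phi : R[i]^o -> R[i]^o)
    (G : R -> R[i]^o) (K : R) :
  (forall u s t, u <= s <= t ->
    rnorm ((c t - c u) * phi (c s) - (G t - G u)) <= K * (t - u) ^+ 2) ->
  is_complex_integral c phi (G 1 - G 0).
Proof.
move=> H; apply/path_integralP => e e0.
have K0 : 0 <= K.
  have := H 0 0 1; rewrite lexx ler01 subr0 expr1n mulr1 => /(_ isT).
  exact: le_trans (rnorm_ge0 _).
have K1 : 0 < K + 1 by rewrite ltr_wpDl.
exists (e / (K + 1)); first by rewrite divr_gt0.
move=> t s [pt ts]; rewrite lee_fin.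
rewrite -(partition_telescope G pt) /riemann_sum -sumrB.
apply: le_trans (rnorm_sum _ _ _) _.
pose D := fun i => nth 0 t i - nth 0 (0 :: t) i.
apply: (@le_trans _ _ (\sum_(i < size t) (e / (K + 1) * K) * D i)).
  apply: ler_sum => i _; have [sE Dd] := ts i (ltn_ord i).
  apply: le_trans (H _ _ _ sE) _.
  have [_ _ D0] := partition_pt pt (ltn_ord i).
  rewrite expr2 mulrA ler_wpM2r ?subr_ge0 ?(ltW D0)//.
  by rewrite mulrC ler_wpM2r// ltW.
rewrite -mulr_sumr (partition_telescope id pt) subr0 mulr1.
by rewrite -mulrA ger_pMr// ler_pdivrMl// mulr1 lerDl.
Qed.

End PathIntegrals.

(** * Integrals of monomials over a circle *)

Section Expi.
Context {R : realType}.
Local Open Scope complex_scope.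
Local Open Scope ring_scope.
Implicit Types x y s t u : R.

Lemma expiD x y : expi (x + y) = expi x * expi y.
Proof.
apply/eqP; rewrite eq_complex /= cosD sinD; apply/andP; split; apply/eqP => //.
by rewrite addrC.
Qed.

Lemma expi0 : expi (0 : R) = 1.
Proof. by rewrite /expi cos0 sin0. Qed.

Lemma rnorm_expi x : rnorm (expi x : R[i]^o) = 1.
Proof. by rewrite /rnorm normc_def/= cos2Dsin2 sqrtr1. Qed.

Lemma expi_neq0 x : expi x != 0.
Proof. by rewrite -(rnorm_eq0 (expi x : R[i]^o)) rnorm_expi oner_eq0. Qed.

Lemma expiMn n x : expi (n%:R * x) = expi x ^+ n.
Proof.
elim: n => [|n IH]; first by rewrite mul0r expi0.
by rewrite -natr1 mulrDl mul1r expiD IH exprSr.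
Qed.

Lemma expiN x : expi (- x) = (expi x)^-1.
Proof.
by apply: (mulIf (expi_neq0 x)); rewrite mulVf ?expi_neq0// -expiD addNr expi0.
Qed.

Lemma expi2pi : expi (pi *+ 2 : R) = 1.
Proof.
by rewrite /expi cos2pi mulr2n sinD sinpi mul0r mulr0 addr0.
Qed.

Lemma abs_sin_le x : `|sin x| <= `|x|.
Proof.
wlog x0 : x / 0 <= x.
  move=> H; have [/H//|x0] := leP 0 x.
  by rewrite -normrN -sinN -[leRHS]normrN H// oppr_ge0 ltW.
have [c _] : exists2 c, c \in `[0, x] & sin x - sin 0 = cos c * (x - 0).
  by apply: MVT_segment => //; apply: continuous_subspaceT; exact: continuous_sin.
rewrite sin0 !subr0 => ->; rewrite normrM ler_piMl//.
by rewrite ler_norml cos_geN1 cos_le1.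
Qed.

Lemma cos_le_sqr x : 0 <= 1 - cos x <= x ^+ 2 / 2.
Proof.
rewrite subr_ge0 cos_le1/=.
have h : sin (x / 2) ^+ 2 <= x ^+ 2 / 4.
  have -> : x ^+ 2 / 4 = (x / 2) ^+ 2 by field.
  rewrite -(real_normK (num_real (sin _))) -[leRHS](real_normK (num_real _)).
  by rewrite lerXn2r ?nnegrE// abs_sin_le.
have -> : cos x = 1 - sin (x / 2) ^+ 2 * 2.
  have -> : cos x = cos ((x / 2) *+ 2) by congr cos; field.
  by rewrite cos_mulr2n cos2sin2; ring.
nra.
Qed.

Lemma cos_le_abs x : 1 - cos x <= `|x|.
Proof.
have [x2|x2] := leP `|x| 2; last by have := cos_geN1 x; lra.
have /andP[_] := cos_le_sqr x; rewrite -(real_normK (num_real x)) => h.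
by apply: le_trans h _; have := normr_ge0 x; nra.
Qed.

Lemma expi_lipschitz t u : rnorm (expi t - expi u : R[i]^o) <= `|t - u| *+ 2.
Proof.
have -> : expi t - expi u = expi u * (expi (t - u) - 1).
  by rewrite mulrBr mulr1 -expiD subrKC.
rewrite rnormM rnorm_expi mul1r; apply: le_trans (rnorm_le_ReIm _) _.
rewrite mulr2n lerD//= ?subr0 ?abs_sin_le//.
rewrite -normrN opprB ger0_norm ?cos_le_abs// subr_ge0 cos_le1.
Qed.

(** A quadratic error is what Riemann sums require; the mean value theorem gives
    it because the derivative [cos - 1] is at most [`|x|] in absolute value. *)
Lemma sin_sub_le x : `|sin x - x| <= x ^+ 2.
Proof.
wlog x0 : x / 0 <= x.
  move=> H; have [/H//|x0] := leP 0 x.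
  by have := H (- x); rewrite oppr_ge0 (ltW x0) sinN -opprD normrN sqrrN; exact.
have [c] : exists2 c, c \in `[0, x] & sin x - sin 0 = cos c * (x - 0).
  by apply: MVT_segment => //; apply: continuous_subspaceT; exact: continuous_sin.
rewrite in_itv/= sin0 !subr0 => /andP[c0 cx] ->.
have /andP[h1 _] := cos_le_sqr c.
have h2 : 1 - cos c <= x by apply: le_trans (cos_le_abs c) _; rewrite ger0_norm.
by rewrite ler_norml; nra.
Qed.

Lemma expi_taylor x : rnorm (expi x - 1 - 'i%C * x%:C : R[i]^o) <= x ^+ 2 *+ 2.
Proof.
apply: le_trans (rnorm_le_ReIm _) _; rewrite mulr2n lerD//=.
- rewrite mul0r mul1r !subr0 -normrN opprB.
  have /andP[h0 h] := cos_le_sqr x; rewrite ger0_norm//.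
  by apply: le_trans h _; have := sqr_ge0 x; lra.
- by rewrite mul0r mul1r add0r subr0 sin_sub_le.
Qed.

(** The derivative of [expi] may be taken at any tag [s] near [t] and [u]: after
    a rotation by [- s], this is Taylor's estimate at 0 for [t - s] and [u - s]. *)
Lemma expi_increment t u s (d : R) : `|t - s| <= d -> `|u - s| <= d ->
  rnorm (expi t - expi u - 'i%C * (t - u)%:C * expi s : R[i]^o) <=
  d ^+ 2 *+ 4.
Proof.
move=> td ud.
have -> : expi t - expi u - 'i%C * (t - u)%:C * expi s =
    expi s * ((expi (t - s) - 1 - 'i%C * (t - s)%:C) -
              (expi (u - s) - 1 - 'i%C * (u - s)%:C)).
  by rewrite -{1}(subrK s t) -{1}(subrK s u) !expiD !rmorphB/=; ring.
rewrite rnormM rnorm_expi mul1r; apply: le_trans (rnormD _ _) _.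
rewrite rnormN.
have sq y : `|y| <= d -> y ^+ 2 *+ 2 <= d ^+ 2 *+ 2.
  move=> yd; rewrite lerMn2r -(real_normK (num_real y)).
  by rewrite lerXn2r ?nnegrE// (le_trans _ yd).
have := le_trans (expi_taylor (t - s)) (sq _ td).
have := le_trans (expi_taylor (u - s)) (sq _ ud).
rewrite -[4%N]/(2 + 2)%N mulrnDr; exact: (fun a b => lerD b a).
Qed.

End Expi.

Section Circle.
Context {R : realType}.
Local Open Scope complex_scope.
Local Open Scope ring_scope.
Variables a rho : R.

(** In this coordinate the disc of centre and radius [a] is the unit disc, and
    [L - l] is [a] times the difference of [coord l] and [1 - L / a]. *)
Definition coord (l : R[i]^o) : R[i]^o := 1 - l / a%:C.

(** The circle of centre [a] and radius [a * rho]; it starts at its leftmost point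
    so that its [coord] is [rho] times [expi] exactly. *)
Definition circle (t : R) : R[i]^o := a%:C * (1 - rho%:C * expi (pi *+ 2 * t)).

Hypotheses (a_gt0 : 0 < a) (rho_gt0 : 0 < rho).

Let aC : a%:C != 0 :> R[i].
Proof. by rewrite realC_eq0 gt_eqF. Qed.

Let rC : rho%:C != 0 :> R[i].
Proof. by rewrite realC_eq0 gt_eqF. Qed.

Lemma coordK l : a%:C * (1 - coord l) = l.
Proof. by rewrite /coord opprB addrC subrK mulrC divfK. Qed.

Lemma coord_circle t : coord (circle t) = rho%:C * expi (pi *+ 2 * t).
Proof. by rewrite /coord /circle mulrAC divff// mul1r opprB addrC subrK. Qed.

Lemma rnorm_coord_circle t : rnorm (coord (circle t)) = rho.
Proof. by rewrite coord_circle rnormM rnorm_expi mulr1 rnormR gtr0_norm. Qed.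

Lemma circle_increment t u : circle t - circle u =
  - (a * rho)%:C * (expi (pi *+ 2 * t) - expi (pi *+ 2 * u)).
Proof. by rewrite /circle rmorphM/=; ring. Qed.

Lemma circle_lipschitz t u :
  rnorm (circle t - circle u) <= a * rho * (pi *+ 4) * `|t - u|.
Proof.
rewrite circle_increment rnormM -rmorphN/= rnormR normrN.
rewrite (gtr0_norm (mulr_gt0 a_gt0 rho_gt0)) -mulrA ler_wpM2l//.
  by rewrite ltW// mulr_gt0.
apply: le_trans (expi_lipschitz _ _) _; rewrite -mulrBr normrM.
have := pi_ge0 R; move: (pi : R) => p p0.
by rewrite ger0_norm ?mulrn_wge0// !mulrnAl -mulrnA.
Qed.

(** The primitive of [exp (i n x)] is periodic unless [n = 0], in which case it
    increases by [2 pi i] over a period. *)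
Lemma expi_primitive (n : R) : expi (pi *+ 2 * n) = 1 ->
  exists (G : R -> R[i]^o) (K : R),
    G 1 - G 0 = (if n == 0 then two_pi_i R else 0) /\
    forall u s t, u <= s <= t ->
      rnorm ('i%C * (pi *+ 2 * (t - u))%:C * expi (n * (pi *+ 2 * s)) -
        (G t - G u) : R[i]^o) <= K * (t - u) ^+ 2.
Proof.
move=> n1; have [->|n0] := eqVneq n 0.
  exists (fun t => 'i%C * (pi *+ 2 * t)%:C), 0; split.
    by rewrite /two_pi_i complexiE mulr1 mulr0 mulr0 subr0 mulrC.
  move=> u s t _; rewrite mul0r mul0r expi0 mulr1 mulrBr rmorphB/= mulrBr subrr.
  by rewrite rnorm0.
have nC : n%:C != 0 :> R[i] by rewrite realC_eq0.
exists (fun t => (n^-1)%:C * expi (n * (pi *+ 2 * t))).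
exists (`|n^-1| * (`|n * (pi *+ 2)| ^+ 2 *+ 4)); split.
  by rewrite mulr1 !mulr0 expi0 (mulrC n) n1 subrr.
move=> u s t /andP[us st].
have -> : 'i%C * (pi *+ 2 * (t - u))%:C * expi (n * (pi *+ 2 * s)) -
    ((n^-1)%:C * expi (n * (pi *+ 2 * t)) - (n^-1)%:C * expi (n * (pi *+ 2 * u))) =
  - ((n^-1)%:C * (expi (n * (pi *+ 2 * t)) - expi (n * (pi *+ 2 * u)) -
      'i%C * (n * (pi *+ 2 * t) - n * (pi *+ 2 * u))%:C * expi (n * (pi *+ 2 * s)))).
  rewrite -(mulrBr n) -(mulrBr (pi *+ 2)) (rmorphM _ n)/= fmorphV/=.
  by field.
rewrite rnormN rnormM rnormR -[leRHS]mulrA ler_wpM2l//.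
rewrite [leRHS]mulrnAl -exprMn.
apply: expi_increment.
  rewrite -!mulrBr mulrA normrM ler_wpM2l// ler_norml; lra.
by rewrite -!mulrBr mulrA normrM ler_wpM2l// ler_norml; lra.
Qed.

(** Along the circle the velocity is a constant multiple of [expi (pi *+ 2 * t)],
    and the integrand times the velocity is a constant multiple of
    [expi ((j - k) * (pi *+ 2 * t))].  The sign is that of [l = a (1 - coord l)]. *)
Lemma circle_integral_monomial (j k : nat) :
  is_complex_integral circle (fun l => coord l ^+ j * coord l ^- k.+1)
    (if j == k then - (two_pi_i R * a%:C) else 0).
Proof.
pose n : R := j%:R - k%:R; pose w : R[i] := - (a * rho ^+ j / rho ^+ k)%:C.
have [|G [K [G01 GK]]] := @expi_primitive n.
  rewrite mulrBr expiD expiN (mulrC _ j%:R) (mulrC _ k%:R) !expiMn expi2pi.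
  by rewrite !expr1n invr1 mulr1.
have -> : (if j == k then - (two_pi_i R * a%:C) else 0) = w * G 1 - w * G 0.
  rewrite -mulrBr G01 subr_eq0 eqr_nat /w; case: eqVneq => [->|_]; rewrite ?mulr0//.
  by rewrite -mulrA divff ?mulr1 ?mulNr 1?mulrC// expf_neq0// gt_eqF.
pose K1 := `|pi *+ 2| ^+ 2 *+ 4 + K.
apply: (@path_integral_primitive _ _ _ (fun t => w * G t)
  (rnorm (w : R[i]^o) * K1)) => u s t ust.
have -> : (circle t - circle u) *
      (coord (circle s) ^+ j * coord (circle s) ^- k.+1) =
    w * ((expi (pi *+ 2 * t) - expi (pi *+ 2 * u)) *
      expi ((n - 1) * (pi *+ 2 * s))).
  rewrite circle_increment coord_circle /w /n -addrA -opprD natr1.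
  rewrite (mulrBl _ j%:R) expiD expiN !expiMn !rmorphM/= fmorphV/= !rmorphXn/=.
  rewrite !exprMn !exprS; field.
  by rewrite rC expi_neq0 expf_neq0 ?expi_neq0 ?expf_neq0.
rewrite -!mulrBr rnormM -mulrA ler_wpM2l ?rnorm_ge0//.
have [us st] := andP ust.
apply: le_trans (rnormDB
  ('i%C * (pi *+ 2 * (t - u))%:C * expi (n * (pi *+ 2 * s)) : R[i]^o) _ _) _.
rewrite [K1 * _]mulrDl lerD//; last exact: GK.
have -> : n * (pi *+ 2 * s) = pi *+ 2 * s + (n - 1) * (pi *+ 2 * s) by ring.
rewrite expiD (mulrA ('i%C * _)) -mulrBl rnormM rnorm_expi mulr1 mulrBr.
rewrite [leRHS]mulrnAl -exprMn; apply: expi_increment.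
  by rewrite -!mulrBr normrM ler_wpM2l// ler_norml; lra.
by rewrite -!mulrBr normrM ler_wpM2l// ler_norml; lra.
Qed.

End Circle.

(** * Geometric series on a circle *)

Section CircleGeometric.
Context {R : realType}.
Local Open Scope complex_scope.
Local Open Scope ring_scope.
Variables a rho : R.
Hypotheses (a_gt0 : 0 < a) (rho_gt0 : 0 < rho).

Lemma geometric_le (C x e : R) : 0 <= x < 1 -> 0 < e ->
  exists m0 : nat, forall m, (m0 <= m)%N -> C * x ^+ m <= e.
Proof.
move=> /andP[x0 x1] e0.
have : (fun m => C * x ^+ m) @ \oo --> C * 0.
  by apply: cvgMl_tmp; apply: cvg_expr; rewrite ger0_norm.
rewrite mulr0 => /cvgrPdist_le /(_ e e0) [m0 _ H].
exists m0 => m mm; have := H m mm; rewrite /= sub0r normrN.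
exact: le_trans (ler_norm _).
Qed.

Lemma circle_length t : itv_partition 0 1 t ->
  \sum_(i < size t) rnorm (circle a rho (nth 0 t i) - circle a rho (nth 0 (0 :: t) i))
    <= a * rho * (pi *+ 4).
Proof.
move=> pt.
apply: (@le_trans _ _ (\sum_(i < size t)
   a * rho * (pi *+ 4) * (nth 0 t i - nth 0 (0 :: t) i))).
  apply: ler_sum => i _; apply: le_trans (circle_lipschitz a_gt0 rho_gt0 _ _) _.
  by have [_ _ h] := partition_pt pt (ltn_ord i); rewrite gtr0_norm// subr_gt0.
by rewrite -mulr_sumr (partition_telescope id pt) subr0 mulr1.
Qed.

(** [F] is the sum of a series that converges uniformly on the circle; after
    multiplication by [coord ^+ j], the only term without a periodic primitive
    is the one that contains [coord ^-1], which is the [j]-th. *)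
Lemma circle_integral_geometric (V : lmodType R[i]) (N : V -> \bar R)
    (v : nat -> V) (F : R[i]^o -> V) (q C : R) (j : nat) :
  is_ext_norm N -> 0 <= q < rho -> (forall k, (N (v k) <= (q ^+ k)%:E)%E) ->
  (forall l m, rnorm (coord a l) = rho ->
    (N (F l - \sum_(k < m) (coord a l ^- k.+1 : R[i]) *: v k)%R
       <= (C * (q / rho) ^+ m)%:E)%E) ->
  is_path_integral N (circle a rho) (fun l => (coord a l ^+ j : R[i]) *: F l)
    (- (two_pi_i R * a%:C) *: v j).
Proof.
move=> HN /andP[q0 qr] Nv NF.
apply: (path_integral_lim HN circle_length) => e e0.
have x01 : 0 <= q / rho < 1 by rewrite divr_ge0 ?(ltW rho_gt0)//= ltr_pdivrMr// mul1r.
have [m0 Hm0] := geometric_le (rho ^+ j * C) x01 e0.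
pose m := maxn m0 j.+1.
exists (fun l => \sum_(k < m) (coord a l ^+ j * coord a l ^- k.+1 : R[i]) *: v k).
exists (\sum_(k < m) (if j == k then - (two_pi_i R * a%:C) else 0) *: v k).
split.
- apply: (path_integral_sum HN m
    (f := fun k l => (coord a l ^+ j * coord a l ^- k.+1 : R[i]) *: v k)
    (J := fun k => (if j == k then - (two_pi_i R * a%:C) else 0) *: v k)) => k.
  by apply: (path_integral_scale HN (Nv k)); exact: circle_integral_monomial.
- have jm : (j < m)%N by rewrite leq_max ltnSn orbT.
  rewrite (bigD1 (Ordinal jm))//= eqxx big1 => [|i]; last first.
    by rewrite -val_eqE/= eq_sym => /negbTE ->; rewrite scale0r.
  rewrite addr0 subrr; apply: le_trans (ext_norm0 HN) _.
  by rewrite lee_fin ltW.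
- move=> x _; set l := circle a rho x.
  have lr : rnorm (coord a l) = rho by exact: rnorm_coord_circle.
  have -> : \sum_(k < m) (coord a l ^+ j * coord a l ^- k.+1 : R[i]) *: v k =
      (coord a l ^+ j : R[i]) *: \sum_(k < m) (coord a l ^- k.+1 : R[i]) *: v k.
    by rewrite scaler_sumr; apply: eq_bigr => k _; rewrite scalerA.
  rewrite -scalerBr; apply: le_trans (ext_normZ HN _ (NF l m lr)) _.
  by rewrite rnormX lr lee_fin mulrA Hm0// leq_maxl.
Qed.

Lemma geometric_sum_error (x y : R[i]) m : x != 0 -> y != x ->
  (x - y)^-1 - \sum_(k < m) x ^- k.+1 * y ^+ k = (x - y)^-1 * (y / x) ^+ m.
Proof.
move=> x0 yx; have xy : x - y != 0 by rewrite subr_eq0 eq_sym.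
elim: m => [|m IH]; first by rewrite big_ord0 subr0 mulr1.
rewrite big_ord_recr/= opprD addrA IH !exprMn !exprVn !exprS; field.
by rewrite x0 xy expf_neq0.
Qed.

(** In terms of coordinates, [(w - z)^-1] is [- a^-1 * (coord w - coord z)^-1],
    the sum of a geometric series of ratio [coord z / coord w]. *)
Lemma circle_winding_number (z : R[i]^o) :
  rnorm (coord a z) < rho -> winding_number_eq (circle a rho) z 1.
Proof.
move=> zr; set y := coord a z.
have aC : a%:C != 0 :> R[i] by rewrite realC_eq0 gt_eqF.
pose F l : R[i]^o := (coord a l - y)^-1.
have : is_complex_integral (circle a rho) (fun l => coord a l ^+ 0 *: F l)
    (- (two_pi_i R * a%:C) *: (y ^+ 0 : R[i]^o)).
  apply: (@circle_integral_geometric R[i]^o _ (fun k => y ^+ k) F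
    (rnorm y) (rho - rnorm y)^-1).
  - exact: rnorm_is_ext_norm.
  - by rewrite rnorm_ge0.
  - by move=> k; rewrite rnormX.
  move=> l m lr.
  have l0 : coord a l != 0 by rewrite -rnorm_eq0 lr gt_eqF.
  have yl : y != coord a l by apply: contraTneq zr => h; rewrite -/y h lr ltxx.
  rewrite /F [X in rnorm X](_ : _ = (coord a l - y)^-1 * (y / coord a l) ^+ m).
    rewrite rnormM rnormX rnormM rnormV rnormV lr lee_fin ler_wpM2r//.
      by rewrite exprn_ge0// divr_ge0 ?rnorm_ge0// ltW.
    rewrite lef_pV2 ?posrE ?subr_gt0//; last by rewrite rnorm_gt0 subr_eq0 eq_sym.
    by rewrite lerBlDl -lr; exact: rnorm_le_sub.
  by rewrite -geometric_sum_error.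
move=> /(path_integralZ rnorm_is_ext_norm (- a%:C^-1)).
rewrite /winding_number_eq /is_complex_integral.
congr is_path_integral.
- apply/funext => l; apply: (etrans (_ : _ = - a%:C^-1 * (1 * F l)))=> //.
  rewrite /F /y /coord mul1r.
  have -> : 1 - l / a%:C - (1 - z / a%:C) = - a%:C^-1 * (l - z) by ring.
  by rewrite invfM invrN invrK mulrA mulrNN mulVf// mul1r.
- apply: (etrans (_ : _ = - a%:C^-1 * (- (two_pi_i R * a%:C) * 1))) => //.
  by rewrite mulr1 mulrNN mulrCA mulVf// mulr1.
Qed.

End CircleGeometric.

(** * Circles are closed paths *)

Section CirclePath.
Context {R : realType}.
Local Open Scope complex_scope.
Local Open Scope ring_scope.

(** The angle is the arccosine of the normalized real part, up to the sign of the
    imaginary part; a negative imaginary part excludes the angle [- pi]. *)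
Lemma polar_form (z : R[i]^o) :
  exists x : R, - pi < x <= pi /\ z = (rnorm z)%:C * expi x.
Proof.
have [->|z0] := eqVneq z 0.
  by exists 0; rewrite rnorm0 mul0r pi_ge0 andbT oppr_lt0 pi_gt0.
have rz : rnorm z != 0 by rewrite rnorm_eq0.
have h := sqr_rnorm z.
set c := complex.Re z / rnorm z; set s := complex.Im z / rnorm z.
have cs : c ^+ 2 + s ^+ 2 = 1.
  by rewrite /c /s !exprMn -mulrDl -h -exprMn divff// expr1n.
have c1 : -1 <= c <= 1.
  have : c ^+ 2 <= 1 by have := sqr_ge0 s; lra.
  by move=> c2; apply/andP; split; nra.
have zE x : cos x = c -> sin x = s -> z = (rnorm z)%:C * expi x.
  move=> cx sx; apply/eqP; rewrite eq_complex /= cx sx !mul0r subr0 addr0.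
  by rewrite /c /s ![rnorm z * _]mulrC !divfK// !eqxx.
have [/andP[a0 api] ca] := acos_def c1.
have sa : sin (acos c) = `|s|.
  by rewrite sin_acos// -sqrtr_sqr; congr Num.sqrt; lra.
have [s0|s0] := leP 0 s.
  exists (acos c); rewrite api andbT; split; last first.
    by rewrite {1}(zE (acos c))// sa ger0_norm.
  by apply: lt_le_trans a0; rewrite oppr_lt0 pi_gt0.
exists (- acos c); split; last by apply: zE; rewrite ?cosN// sinN sa ltr0_norm// opprK.
rewrite ltrN2 lt_neqAle api andbT; apply/andP; split.
  apply: contraTneq s0 => h'; rewrite -leNgt.
  by move: sa; rewrite h' sinpi => /eqP; rewrite eq_sym normr_eq0 => /eqP ->.
by apply: le_trans (pi_ge0 R); rewrite oppr_le0.
Qed.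

(** By the half-angle formula, [1 - cos y] is [2 * sin (y / 2) ^+ 2]. *)
Lemma expi_eq1 (x : R) : - (pi *+ 2) < x < pi *+ 2 -> expi x = 1 -> x = 0.
Proof.
have pos (y : R) : 0 < y < pi *+ 2 -> expi y <> 1.
  move=> /andP[y0 ypi] [cy _]; have : 0 < sin (y / 2).
    by apply: sin_gt0_pi; rewrite divr_gt0//= ltr_pdivrMr// mulr_natr.
  have : cos y = 1 - sin (y / 2) ^+ 2 * 2.
    have -> : cos y = cos ((y / 2) *+ 2) by congr cos; field.
    by rewrite cos_mulr2n cos2sin2; ring.
  by rewrite cy; nra.
move=> /andP[x1 x2] e1; have [x0|x0|//] := ltgtP x 0.
- by case: (pos (- x)); rewrite ?expiN ?e1 ?invr1// oppr_gt0 x0 ltrNl.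
- by case: (pos x); rewrite // x0.
Qed.

Lemma near_dist_le (K : numFieldType) (V : normedModType K) (x : V) (e : K) :
  0 < e -> \forall y \near x, `|x - y| <= e.
Proof. by move=> e0; apply: (@cvgr_dist_le _ _ _ _ _ id x _ e e0); exact: cvg_id. Qed.

Lemma lipschitz_continuous (V : normedModType R[i]) (f : V -> R) (K : R) :
  0 < K -> (forall x y, f x <= f y + K * rnorm (x - y)) -> continuous f.
Proof.
move=> K0 h z; apply/cvgrPdist_le => e e0.
near=> w.
have : rnorm (z - w) <= K^-1 * e.
  rewrite -lecR -normE.
  by near: w; apply: near_dist_le; rewrite ltcR mulr_gt0// invr_gt0.
rewrite ler_pdivlMl// => zw.
by rewrite ler_norml; have := h z w; have := h w z; rewrite (rnormB w z); lra.
Unshelve. all: by end_near. Qed.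

Variables a rho : R.
Hypotheses (a_gt0 : 0 < a) (rho_gt0 : 0 < rho).
Local Notation c := (circle a rho).

Let aC : a%:C != 0 :> R[i].
Proof. by rewrite realC_eq0 gt_eqF. Qed.

Lemma circle_continuous : continuous c.
Proof.
move=> t; apply/cvgrPdist_le => _ /gt0_realC[d d0 ->].
pose K := a * rho * (pi *+ 4) + 1.
have K0 : 0 < K by rewrite ltr_wpDl// !mulr_ge0 ?ltW// mulrn_wgt0// pi_gt0.
near=> s.
rewrite normE lecR; apply: le_trans (circle_lipschitz a_gt0 rho_gt0 _ _) _.
apply: (@le_trans _ _ (K * `|t - s|)); first by rewrite ler_wpM2r// lerDl.
rewrite -ler_pdivlMl//.
by near: s; apply: (@near_dist_le R R^o); rewrite mulr_gt0// invr_gt0.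
Unshelve. all: by end_near. Qed.

Lemma coord_continuous : continuous (fun l : R[i]^o => rnorm (coord a l)).
Proof.
apply: (@lipschitz_continuous R[i]^o _ a^-1); first by rewrite invr_gt0.
move=> x y; apply: le_trans (rnorm_le_sub _ (coord a y)) _; rewrite lerD2l.
have -> : coord a x - coord a y = - (a^-1)%:C * (x - y).
  by rewrite /coord fmorphV/=; ring.
by rewrite rnormM -rmorphN/= rnormR normrN gtr0_norm ?invr_gt0.
Qed.

Lemma path_image_circle l : path_image c l <-> rnorm (coord a l) = rho.
Proof.
split=> [[t _ <-]|lr]; first exact: rnorm_coord_circle.
have [x [/andP[x1 x2] lE]] := polar_form (coord a l); rewrite lr in lE.
have p0 : 0 < pi *+ 2 :> R by rewrite mulrn_wgt0// pi_gt0.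
have H y : 0 <= y <= pi *+ 2 -> expi y = expi x -> path_image c l.
  move=> /andP[y0 y1] yx; exists (y / (pi *+ 2)).
    by rewrite /= in_itv/= divr_ge0 ?(ltW p0)//= ler_pdivrMr// mul1r.
  rewrite -(coordK a_gt0 l) lE /circle; congr (_ * (1 - _ * _)).
  by rewrite mulrC divfK ?gt_eqF.
have [x0|x0] := leP 0 x.
  by apply: (H x) => //; rewrite x0 (le_trans x2)// mulr2n lerDl pi_ge0.
apply: (H (x + pi *+ 2)); last by rewrite expiD expi2pi mulr1.
by rewrite mulr2n; apply/andP; split; lra.
Qed.

(** On a connected set that avoids the circle, [rnorm (coord _)] cannot cross the
    value [rho], so the component of a point of the disc stays in the disc.  The
    component of a point outside contains a ray that points away from [a]. *)
Lemma path_interior_circle z :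
  path_interior c z <-> rnorm (coord a z) < rho.
Proof.
split=> [[zc zb]|zr].
  have [//|rz|h] := ltgtP (rnorm (coord a z)) rho; last first.
    by case: zc; exact/path_image_circle.
  exfalso; pose f (s : R) : R[i]^o := a%:C * (1 - s%:C * coord a z).
  have cf s : coord a (f s) = s%:C * coord a z.
    by rewrite /f {1}/coord mulrAC divff// mul1r opprB addrC subrK.
  have z0 : 0 < rnorm (coord a z) by apply: lt_trans rz.
  have f_cont : continuous f.
    move=> s; apply/cvgrPdist_le => _ /gt0_realC[d d0 ->].
    near=> t.
    rewrite normE lecR (_ : f s - f t = (a * (t - s))%:C * coord a z); last first.
      by rewrite /f rmorphM rmorphB/=; ring.
    rewrite rnormM rnormR normrM (gtr0_norm a_gt0) mulrAC distrC.
    rewrite -ler_pdivlMl ?mulr_gt0//.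
    by near: t; apply: (@near_dist_le R R^o); rewrite mulr_gt0// invr_gt0 mulr_gt0.
  have ray : f @` `[1, +oo[ `<=` connected_component (~` path_image c) z.
    apply: connected_component_max.
    - exists 1; first by rewrite /= in_itv/= lexx.
      by rewrite /f mul1r coordK.
    - move=> _ [s + <-] /path_image_circle; rewrite /= in_itv/= andbT => s1.
      rewrite cf rnormM rnormR ger0_norm ?(le_trans ler01)// => h.
      suff : rho < rho by rewrite ltxx.
      by rewrite -{2}h (lt_le_trans rz)// ler_peMl// ltW.
    - apply: connected_continuous_connected; last exact: continuous_subspaceT.
      by apply/connected_intervalP; exact: interval_is_interval.
  have [_ /gt0_realC[m m0 ->] zM] := pinfty_ex_gt0 zb.
  (* far enough along the ray to have modulus greater than [m] *)
  pose s := (m / a + 2) / rnorm (coord a z) + 1.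
  have s1 : 1 <= s by rewrite lerDr divr_ge0 ?rnorm_ge0// addr_ge0// divr_ge0// ltW.
  have := zM (f s) (ray _ _); rewrite /= normE lecR => H.
  have {H} : rnorm (f s) <= m.
    by apply: H; exists s => //; rewrite /= in_itv/= s1.
  apply/negP; rewrite -ltNge.
  have : rnorm (coord a (f s)) <= 1 + rnorm (f s) / a.
    apply: le_trans (rnormD _ _) _.
    by rewrite rnorm1 rnormN rnormM rnormV rnormR (gtr0_norm a_gt0).
  rewrite cf rnormM rnormR ger0_norm ?(le_trans ler01)// /s mulrDl divfK ?gt_eqF// mul1r.
  move=> h; rewrite -(ltr_pM2r (_ : 0 < a^-1)) ?invr_gt0//; lra.
split; first by move=> /path_image_circle h; move: zr; rewrite h ltxx.
exists (a * (1 + rho))%:C; split; first by rewrite complex_real.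
move=> M aM l lz /=; apply: le_trans (ltW aM).
rewrite normE lecR.
have lr : rnorm (coord a l) < rho.
  have /connected_intervalP itv : connected ((fun l => rnorm (coord a l)) @`
      connected_component (~` path_image c) z).
    apply: connected_continuous_connected; first exact: component_connected.
    exact/continuous_subspaceT/coord_continuous.
  have zC : (~` path_image c) z.
    by move=> /path_image_circle h; move: zr; rewrite h ltxx.
  rewrite ltNge; apply/negP => rl.
  have [w wz wr] : [set rnorm (coord a w) |
      w in connected_component (~` path_image c) z] rho.
    apply: (itv (rnorm (coord a z)) (rnorm (coord a l))).
    - by exists z => //; exact: connected_component_refl.
    - by exists l.
    - by rewrite ltW.
  by have := @connected_component_sub _ _ _ _ wz; apply; exact/path_image_circle.
rewrite -(coordK a_gt0 l) rnormM rnormR gtr0_norm// ler_wpM2l ?(ltW a_gt0)//.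
by apply: le_trans (rnormD _ _) _; rewrite rnorm1 rnormN lerD2l ltW.
Unshelve. all: by end_near. Qed.

Lemma circle_closed_path : closed_path c.
Proof.
split.
- exact/continuous_subspaceT/circle_continuous.
- by rewrite /circle mulr0 mulr1 expi0 expi2pi.
- move=> s t; rewrite !in_itv/= => /andP[s0 s1] /andP[t0 t1].
  move=> /(congr1 (coord a)); rewrite !coord_circle//.
  have rC : rho%:C != 0 :> R[i] by rewrite realC_eq0 gt_eqF.
  move=> /(mulfI rC) e.
  have : expi (pi *+ 2 * (s - t)) = 1.
    by rewrite mulrBr expiD expiN e divff// expi_neq0.
  have p0 : 0 < pi *+ 2 :> R by rewrite mulrn_wgt0// pi_gt0.
  have : - (pi *+ 2) < pi *+ 2 * (s - t) < pi *+ 2.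
    by move: (pi *+ 2 : R) p0 => p p0; apply/andP; split; nra.
  move=> /expi_eq1 /[apply] /eqP.
  by rewrite mulf_eq0 gt_eqF//= subr_eq0 => /eqP.
- by exists (a * rho * (pi *+ 4)) => t; exact: circle_length.
- by move=> z /path_interior_circle; exact: circle_winding_number.
Qed.

End CirclePath.

(** * The principal square root on the right half-plane *)

Section Gamma.
Context {R : realType}.
Local Open Scope complex_scope.
Local Open Scope ring_scope.
Implicit Types z w : R[i]^o.

Lemma Arg_spec z : - pi < Arg z <= pi /\ z = (rnorm z)%:C * expi (Arg z).
Proof. exact: (getPex (polar_form z)). Qed.

Lemma gamma_sqr z : gamma z * gamma z = z.
Proof.
have [_ zE] := Arg_spec z.
rewrite /gamma mulrACA -rmorphM/= -expr2 sqr_sqrtr ?rnorm_ge0// -expiD.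
by rewrite -splitr.
Qed.

Lemma Re_gamma_ge0 z : 0 <= complex.Re (gamma z).
Proof.
have [/andP[a1 a2] _] := Arg_spec z; rewrite /gamma /= mul0r subr0.
rewrite mulr_ge0 ?sqrtr_ge0// cos_ge0_pihalf//.
rewrite ler_pM2r ?invr_gt0// a2 andbT -mulNr ler_pM2r ?invr_gt0//.
exact: ltW.
Qed.

Lemma Re_gamma_gt0 z : Theta z -> 0 < complex.Re (gamma z).
Proof.
move=> zT; have z0 : 0 < complex.Re z by [].
rewrite lt_def Re_gamma_ge0 andbT.
apply: contraTN z0 => g0; rewrite -leNgt -(gamma_sqr z).
move/eqP: g0; move: (gamma z) => [x y] /= ->.
by rewrite mul0r sub0r oppr_le0 -expr2 sqr_ge0.
Qed.

Lemma gamma_diff_quotient z w :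
  (gamma w - gamma z) * (gamma w + gamma z) = w - z.
Proof.
by rewrite -[in RHS](gamma_sqr w) -[in RHS](gamma_sqr z); ring.
Qed.

(** A lower bound that does not depend on [w]: with the preceding identity, it
    gives the continuity of [gamma] at [z] and its derivative together. *)
Lemma Re_gamma_le z w : complex.Re (gamma z) <= rnorm (gamma w + gamma z).
Proof.
apply: le_trans (Re_le_rnorm _); apply: le_trans (ler_norm _).
case: (gamma z) (Re_gamma_ge0 w) => x y /=; case: (gamma w) => x' y' /=.
by rewrite lerDr.
Qed.

Lemma open_Theta : open (@Theta R).
Proof.
have h : continuous (fun z : R[i]^o => complex.Re z).
  apply: (@lipschitz_continuous _ R[i]^o _ 1) => // x y.
  rewrite mul1r -lerBlDl; have := Re_le_rnorm (x - y); case: x y => [x x'] [y y'] /=.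
  exact: le_trans (ler_norm _).
apply: (@open_comp _ _ (fun z : R[i]^o => complex.Re z) [set x | 0 < x]).
  by move=> x _; exact: h.
exact: open_gt.
Qed.

(** For [y] and [x] the square roots of [h + z] and [z], this is the error of the
    difference quotient of the square root; it is of order [h]. *)
Lemma quotient_diff (F : fieldType) (h x y z : F) :
  h != 0 -> x + x != 0 -> y + x != 0 -> (y - x) * (y + x) = (h + z) - z ->
  (x + x)^-1 - h^-1 * (y - x) = h * ((y + x)^-1 ^+ 2 * (x + x)^-1).
Proof.
rewrite addrK => h0 u0 v0 hE; rewrite -{}hE in h0 *.
have e : y - x = (y + x) - (x + x) by ring.
move: h0; rewrite {}e mulf_eq0 => /norP[d0 _].
by move: (y + x) (x + x) u0 v0 d0 => v u u0 v0 d0; field; rewrite u0 v0 d0.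
Qed.

Lemma gamma_holomorphic : holomorphic_on (@Theta R) (@gamma R).
Proof.
move=> z zT.
have g0 := Re_gamma_gt0 zT.
set k := complex.Re (gamma z) in g0.
apply/cvg_ex; exists ((gamma z + gamma z)^-1 : R[i]^o).
apply/cvgrPdist_le => _ /gt0_realC[d d0 ->].
have k3 : 0 < d * k ^+ 3 by rewrite mulr_gt0// exprn_gt0.
near=> h.
have hk : rnorm (h : R[i]^o) <= d * k ^+ 3.
  by rewrite -lecR -normE; near: h; apply: dnbhs0_le; rewrite ltcR.
have h0 : h != 0 by near: h; exact: nbhs_dnbhs_neq.
rewrite (_ : h^-1 *: _ = h^-1 *: (gamma (h + z) - gamma z)); last first.
  by congr (_ *: (gamma (_ + z) - _)); exact: mulr1.
have D0 u : gamma u + gamma z != 0.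
  by rewrite -rnorm_eq0 gt_eqF// (lt_le_trans g0)// Re_gamma_le.
have -> : (gamma z + gamma z)^-1 - h^-1 *: (gamma (h + z) - gamma z) =
    h * ((gamma (h + z) + gamma z)^-1 ^+ 2 * (gamma z + gamma z)^-1) :> R[i]^o.
  exact: (quotient_diff h0 (D0 z) (D0 _) (gamma_diff_quotient z (h + z))).
rewrite normE lecR !rnormM !rnormV -expr2.
have kinv u : (rnorm (gamma u + gamma z))^-1 <= k^-1.
  by rewrite lef_pV2 ?posrE ?Re_gamma_le// rnorm_gt0.
apply: (@le_trans _ _ (d * k ^+ 3 * (k^-1 ^+ 2 * k^-1))); last first.
  by rewrite -exprSr exprVn mulfK// expf_neq0// gt_eqF.
rewrite ler_pM ?rnorm_ge0 ?mulr_ge0 ?exprn_ge0 ?invr_ge0 ?rnorm_ge0//.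
rewrite ler_pM ?exprn_ge0 ?invr_ge0 ?rnorm_ge0//.
by rewrite lerXn2r ?nnegrE ?invr_ge0 ?rnorm_ge0// ltW.
Unshelve. all: by end_near. Qed.

End Gamma.

(** * Polynomials in an operator *)

(** For maps whose linearity is a hypothesis and not part of a structure. *)
Section LinearMaps.
Context {K : pzRingType} {V W : lmodType K}.
Variable A : V -> W.
Hypothesis A_linear : linear A.

Lemma linear_at0 : A 0 = 0.
Proof. by have := A_linear (-1) 0 0; rewrite addr0 !scaleN1r oppr0 addNr. Qed.

Lemma linear_scale k x : A (k *: x) = k *: A x.
Proof. by have := A_linear k x 0; rewrite !addr0 linear_at0 addr0. Qed.

Lemma linear_sub x y : A (x - y) = A x - A y.
Proof. by rewrite addrC -scaleN1r A_linear scaleN1r addrC. Qed.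

End LinearMaps.

Section PolyOp.
Context {R : realType} {H : lmodType R[i]}.
Variable B : {linear H -> H}.
Local Open Scope complex_scope.
Local Open Scope ring_scope.
Implicit Types (p q : {poly R[i]}) (x y : H) (k : R[i]).

Lemma iter_linear n k x y :
  iter n B (k *: x + y) = k *: iter n B x + iter n B y.
Proof. by elim: n => //= n ->; rewrite linearP. Qed.

Definition poly_op p : H -> H := \sum_(i < size p) p`_i *: (iter i B : H -> H).

Lemma poly_opE p n x : (size p <= n)%N ->
  poly_op p x = \sum_(i < n) p`_i *: iter i B x.
Proof.
move=> pn; rewrite /poly_op fct_sumE/= (big_ord_widen _ (fun i => p`_i *: iter i B x) pn).
rewrite big_mkcond; apply: eq_bigr => i _.
by case: ltnP => // pi; rewrite nth_default// scale0r.
Qed.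

Lemma poly_op_linear p k x y :
  poly_op p (k *: x + y) = k *: poly_op p x + poly_op p y.
Proof.
rewrite !(poly_opE _ (leqnn _)) scaler_sumr -big_split/=.
by apply: eq_bigr => i _; rewrite iter_linear scalerDr !scalerA mulrC.
Qed.

Lemma poly_opD p q x : poly_op (p + q) x = poly_op p x + poly_op q x.
Proof.
pose n := maxn (size p) (size q).
rewrite !(@poly_opE _ n) ?leq_maxl ?leq_maxr ?(leq_trans (size_polyD _ _))//.
by rewrite -big_split; apply: eq_bigr => i _; rewrite coefD scalerDl.
Qed.

Lemma poly_opZ k p x : poly_op (k *: p) x = k *: poly_op p x.
Proof.
rewrite !(@poly_opE _ (size p)) ?size_scale_leq// scaler_sumr.
by apply: eq_bigr => i _; rewrite coefZ scalerA.
Qed.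

Lemma poly_op0 x : poly_op 0 x = 0.
Proof. by rewrite (@poly_opE _ 0) ?size_poly0// big_ord0. Qed.

Lemma poly_op1 x : poly_op 1 x = x.
Proof. by rewrite (@poly_opE _ 1) ?size_poly1// big_ord1 coefC scale1r. Qed.

Lemma poly_opMX p x : poly_op ('X * p) x = B (poly_op p x).
Proof.
rewrite (@poly_opE _ (size p).+1) ?(leq_trans (size_polyMleq _ _)) ?size_polyX//.
rewrite big_ord_recl coefXM scale0r add0r (poly_opE _ (leqnn _)) linear_sum.
by apply: eq_bigr => i _; rewrite coefXM linearZ.
Qed.

Lemma poly_opX x : poly_op 'X x = B x.
Proof. by rewrite -['X]mulr1 poly_opMX poly_op1. Qed.

Lemma poly_opM p q x : poly_op (p * q) x = poly_op p (poly_op q x).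
Proof.
(* the hypothesis is used for ['X * q] on the left and for ['X] on the right *)
elim/poly_ind: p q x => [|p k IH] q x; first by rewrite mul0r !poly_op0.
rewrite mulrDl -mulrA mul_polyC -alg_polyC !poly_opD !poly_opZ poly_op1.
by rewrite !IH poly_opMX poly_opX.
Qed.

Lemma poly_op_commute (S : {linear H -> H}) p x :
  (forall x, S (B x) = B (S x)) -> S (poly_op p x) = poly_op p (S x).
Proof.
move=> SB; elim/poly_ind: p x => [|p k IH] x; first by rewrite !poly_op0 linear0.
rewrite -alg_polyC !poly_opD !poly_opZ !poly_op1 linearD linearZ/=.
by rewrite !poly_opM !poly_opX IH SB.
Qed.

End PolyOp.

(** On the one-dimensional space of scalars, evaluation at a point is the case
    of the multiplication operator. *)
Lemma poly_op_mul {R : realType} (z : R[i]) (p : {poly R[i]}) :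
  poly_op (GRing.scale z : {linear R[i]^o -> R[i]^o}) p 1 = p.[z].
Proof.
rewrite (poly_opE _ _ (leqnn _)) horner_coef; apply: eq_bigr => i _.
by congr (_ * _); elim: (i : nat) => //= n ->; rewrite exprS.
Qed.

(** * Geometric limits *)

Lemma geometric_eq0 {R : realType} (H : normedModType R[i])
    (C s : R) (z : H) : 0 <= s < 1 ->
  (forall n, rnorm z <= C * s ^+ n) -> z = 0.
Proof.
move=> s01 h; apply/eqP; rewrite -rnorm_eq0 eq_le rnorm_ge0 andbT.
apply/ler_addgt0Pl => e e0; rewrite addr0.
by have [m Hm] := geometric_le C s01 e0; apply: le_trans (h m) (Hm m _).
Qed.

Section GeometricLimit.
Context {R : realType} {H : completeNormedModType R[i]}.
Local Open Scope complex_scope.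
Local Open Scope ring_scope.

Lemma geometric_tail (C s : R) (u : nat -> H) : 0 <= C -> 0 <= s < 1 ->
  (forall n, rnorm (u n.+1 - u n) <= C * s ^+ n) ->
  forall n k, rnorm (u (n + k)%N - u n) <= C / (1 - s) * s ^+ n.
Proof.
move=> C0 /andP[s0 s1] h n k; have s1' : 0 < 1 - s by rewrite subr_gt0.
have : rnorm (u (n + k)%N - u n) <= C / (1 - s) * (s ^+ n - s ^+ (n + k)).
  elim: k => [|k IH]; first by rewrite addn0 !subrr rnorm0 mulr0.
  rewrite addnS; apply: le_trans (rnormDB (u (n + k)%N) _ _) _.
  apply: le_trans (lerD (h _) IH) _; rewrite exprS.
  rewrite -subr_ge0 [X in 0 <= X](_ : _ = 0)//; field; lra.
move/le_trans; apply; rewrite ler_wpM2l ?divr_ge0 ?(ltW s1')//.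
by rewrite gerBl exprn_ge0.
Qed.

(** The rate makes pointwise limits of operators uniform on the unit ball when
    [C] is a multiple of the norm of the argument. *)
Lemma geometric_limit (C s : R) (u : nat -> H) : 0 <= C -> 0 <= s < 1 ->
  (forall n, rnorm (u n.+1 - u n) <= C * s ^+ n) ->
  exists l : H, forall n, rnorm (l - u n) <= C / (1 - s) * s ^+ n.
Proof.
move=> C0 s01 h; have tail := geometric_tail C0 s01 h.
have small e : 0 < e -> exists m, forall k, rnorm (u (m + k)%N - u m) <= e.
  move=> e0; have [m Hm] := geometric_le (C / (1 - s)) s01 e0.
  by exists m => k; apply: le_trans (tail m k) (Hm m _).
have : cvg (u @ \oo).
  apply/cauchy_cvgP/cauchyP => _ /gt0_realC[d d0 ->].
  have d2 : 0 < d / 2 by rewrite divr_gt0.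
  have [m Hm] := small _ d2.
  exists (u m); exists m => // n /= mn.
  rewrite -ball_normE /ball_/= normE ltcR rnormB -(subnKC mn).
  by apply: le_lt_trans (Hm _) _; rewrite ltr_pdivrMr// ltr_pMr// ltr1n.
move=> /cvg_ex[l ul]; exists l => n.
apply/ler_addgt0Pl => e e0.
have : \forall k \near \oo, `|l - u k| <= e%:C.
  by apply: (@cvgr_dist_le _ _ _ _ _ u l ul); rewrite ltcR.
move=> [k _ /(_ (n + k)%N (leq_addl _ _))]; rewrite /= normE lecR => lk.
by apply: le_trans (rnormDB (u (n + k)%N) _ _) _; rewrite lerD.
Qed.

End GeometricLimit.

(** * Neumann series *)

Lemma subrACA (V : zmodType) (x y z t : V) : x - y - (z - t) = x - z - (y - t).
Proof. by rewrite !opprB [LHS]addrACA [RHS]addrACA (addrC (- y)). Qed.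

Section Neumann.
Context {R : realType} {H : completeNormedModType R[i]}.
Local Open Scope complex_scope.
Local Open Scope ring_scope.
Variables (B : {linear H -> H}) (q : R).
Hypotheses (q_ge0 : 0 <= q) (B_le : forall x, rnorm (B x) <= q * rnorm x).

Lemma iter_le n x : rnorm (iter n B x) <= q ^+ n * rnorm x.
Proof.
elim: n => [|n IH]; first by rewrite mul1r.
by rewrite /= exprS -mulrA; apply: le_trans (B_le _) _; rewrite ler_wpM2l.
Qed.

Lemma sub_scalar_lower_bound (m : R[i]^o) x :
  (rnorm m - q) * rnorm x <= rnorm ((m : R[i]) *: x - B x).
Proof.
rewrite mulrBl lerBlDr -rnormZ.
apply: le_trans (rnorm_le_sub _ ((m : R[i]) *: x - B x)) _.
by rewrite lerD2l opprB addrC subrK B_le.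
Qed.

(** The sum of the series solves [m x - B x = y].  The lower bound above makes the
    solution unique, and uniqueness makes it linear in [y]. *)
Lemma neumann_inverse (m : R[i]^o) : q < rnorm m ->
  exists A : H -> H, is_inverse_op ((m : R[i]) *: idfun - (B : H -> H)) A /\
    forall n x, rnorm (A x - \sum_(k < n) (m ^- k.+1 : R[i]) *: iter k B x) <=
      (rnorm m - q)^-1 * (q / rnorm m) ^+ n * rnorm x.
Proof.
move=> qm; have m0 : 0 < rnorm m by apply: le_lt_trans qm.
have mC : (m : R[i]) != 0 by rewrite -(rnorm_eq0 m) gt_eqF.
have mq0 : 0 < rnorm m - q by rewrite subr_gt0.
have s01 : 0 <= q / rnorm m < 1 by rewrite divr_ge0 ?ltr_pdivrMr ?mul1r ?(ltW m0).
have inj x : (m : R[i]) *: x = B x -> x = 0.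
  move=> h; have := sub_scalar_lower_bound m x; rewrite h subrr rnorm0.
  by rewrite pmulr_rle0// => xle; apply/eqP; rewrite -rnorm_eq0 eq_le xle rnorm_ge0.
have ex y : exists x, (m : R[i]) *: x - B x = y /\
    forall n, rnorm (x - \sum_(k < n) (m ^- k.+1 : R[i]) *: iter k B y) <=
      (rnorm m - q)^-1 * (q / rnorm m) ^+ n * rnorm y.
  pose u n := \sum_(k < n) (m ^- k.+1 : R[i]) *: iter k B y.
  have [|n|l Hl] :=
    @geometric_limit R H ((rnorm m)^-1 * rnorm y) (q / rnorm m) u _ s01.
  - by rewrite mulr_ge0 ?invr_ge0 ?rnorm_ge0.
  - rewrite /u big_ord_recr/= addrC addrK rnormZ rnormV rnormX.
    apply: le_trans (ler_wpM2l _ (iter_le n y)) _.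
      by rewrite invr_ge0 exprn_ge0// rnorm_ge0.
    rewrite exprMn exprVn exprS invfM -subr_ge0 [X in 0 <= X](_ : _ = 0)//; ring.
  have Hl' n : rnorm (l - u n) <= (rnorm m - q)^-1 * (q / rnorm m) ^+ n * rnorm y.
    apply: le_trans (Hl n) _; rewrite -subr_ge0 [X in 0 <= X](_ : _ = 0)//.
    by move: (rnorm m) m0 mq0 => M M0 MQ0; field; rewrite !gt_eqF.
  exists l; split => //.
  apply/eqP; rewrite -subr_eq0; apply/eqP.
  have res n : (m : R[i]) *: u n - B (u n) = y - (m ^- n : R[i]) *: iter n B y.
    elim: n => [|n IH]; first by rewrite /u big_ord0 !linear0 invr1 scale1r addr0 subrr.
    have mn : (m : R[i]) * m ^- n.+1 = m ^- n.
      by rewrite exprSr invfM mulrC -mulrA mulVf// mulr1.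
    rewrite /u big_ord_recr/= -/(u n) (addrC (u n)) (linearP B)/= scalerDr scalerA mn.
    by rewrite opprD addrACA IH addrC subrKA.
  apply: (@geometric_eq0 R H ((rnorm m + q) * (rnorm m - q)^-1 * rnorm y + rnorm y)
    (q / rnorm m)) => // n.
  have -> : (m : R[i]) *: l - B l - y =
      ((m : R[i]) *: (l - u n) - B (l - u n)) - (m ^- n : R[i]) *: iter n B y.
    by rewrite (linearB B)/= scalerBr subrACA res opprB addrA addrAC addrK.
  apply: le_trans (rnormD _ _) _; rewrite rnormN [leRHS]mulrDl lerD//.
    apply: le_trans (rnormD _ _) _; rewrite rnormN rnormZ.
    apply: le_trans (lerD (lexx _) (B_le _)) _.
    rewrite -mulrDl -!mulrA ler_wpM2l ?addr_ge0 ?rnorm_ge0//.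
    by apply: le_trans (Hl' n) _; rewrite -mulrA (mulrC (rnorm y)).
  rewrite rnormZ rnormV rnormX exprMn exprVn [leRHS]mulrA [leRHS]mulrC ler_wpM2l//.
    by rewrite invr_ge0 exprn_ge0// rnorm_ge0.
  by rewrite mulrC iter_le.
have [A HA] := choice ex.
exists A; split; last by move=> n x; exact: (HA x).2.
have solve x y : (m : R[i]) *: x - B x = y -> x = A y.
  move=> xy; apply/eqP; rewrite -subr_eq0; apply/eqP/inj/eqP.
  by rewrite (linearB B)/= scalerBr -subr_eq0 subrACA xy (HA y).1 subrr.
split.
- split.
  + move=> k x y; apply/esym/solve.
    rewrite -[in RHS](HA x).1 -[in RHS](HA y).1 (linearP B)/=.
    by rewrite scalerDr scalerBr opprD addrACA !scalerA mulrC.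
  + exists ((rnorm m - q)^-1) => x.
    by have := (HA x).2 0%N; rewrite big_ord0 subr0 mulr1.
- by move=> x; apply/esym/solve.
- by move=> x; exact: (HA x).1.
Qed.

End Neumann.

(** * The square root of [1 - X] *)

Section SqrtPoly.
Context {R : realType}.
Local Open Scope complex_scope.
Local Open Scope ring_scope.

(** If [y = 1 - sqrt (1 - X)] then [y = (X + y ^ 2) / 2]; these polynomials are
    the iterates of that fixed point equation from 0. *)
Fixpoint sqrt_poly n : {poly R[i]} :=
  if n is m.+1 then 2^-1 *: ('X + sqrt_poly m * sqrt_poly m) else 0.

Section Bounds.
Context {H : normedModType R[i]}.
Variables (B : {linear H -> H}) (q s : R).
Hypotheses (B_le : forall x, rnorm (B x) <= q * rnorm x).
Hypotheses (s_ge0 : 0 <= s) (qs : q + s ^+ 2 <= s *+ 2).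
Local Notation Y n := (poly_op B (sqrt_poly n)).

Lemma sqrt_polyS n x : Y n.+1 x = 2^-1 *: (B x + Y n (Y n x)).
Proof. by rewrite /= poly_opZ poly_opD poly_opX poly_opM. Qed.

Let rnorm2V (z : H) : rnorm ((2^-1 : R[i]) *: z) = 2^-1 * rnorm z.
Proof. by rewrite rnormZ rnormV rnorm_nat. Qed.

(** The hypothesis on [q] and [s] says that the bound [s] is preserved by the
    iteration. *)
Lemma sqrt_poly_le n x : rnorm (Y n x) <= s * rnorm x.
Proof.
elim: n x => [|n IH] x; first by rewrite poly_op0 rnorm0 mulr_ge0// rnorm_ge0.
rewrite sqrt_polyS rnorm2V; apply: le_trans (ler_wpM2l _ (rnormD _ _)) _ => //.
have h : rnorm (Y n (Y n x)) <= s * (s * rnorm x).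
  by apply: le_trans (IH _) _; rewrite ler_wpM2l.
have := B_le x; have := rnorm_ge0 x; move: qs h; rewrite mulr2n.
move: (rnorm (Y n (Y n x))) (rnorm (B x)) (rnorm x) => u v w; nra.
Qed.

(** Half the square is [s]-Lipschitz on the maps of norm at most [s], since
    [Y Y - Z Z = (Y - Z) Y + Z (Y - Z)]. *)
Lemma sqrt_poly_step n x : rnorm (Y n.+1 x - Y n x) <= s * rnorm x * s ^+ n.
Proof.
elim: n x => [|n IH] x.
  by rewrite [X in _ - X]poly_op0 subr0 mulr1 sqrt_poly_le.
have -> : Y n.+2 x - Y n.+1 x = 2^-1 *: (Y n.+1 (Y n.+1 x) - Y n (Y n x)).
  rewrite (sqrt_polyS n.+1) [X in _ - X](sqrt_polyS n) -scalerBr.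
  by rewrite opprD addrACA subrr add0r.
rewrite rnorm2V.
rewrite -(subrKA (Y n (Y n.+1 x))) -(linear_sub (poly_op_linear B _)).
apply: le_trans (ler_wpM2l _ (rnormD _ _)) _ => //.
have h1 : rnorm (Y n.+1 (Y n.+1 x) - Y n (Y n.+1 x)) <= s * rnorm x * s ^+ n.+1.
  apply: le_trans (IH _) _; rewrite exprS mulrA ler_wpM2r ?exprn_ge0//.
  by rewrite -mulrA ler_wpM2l// mulrC sqrt_poly_le.
have h2 : rnorm (Y n (Y n.+1 x - Y n x)) <= s * rnorm x * s ^+ n.+1.
  by apply: le_trans (sqrt_poly_le _ _) _; rewrite exprSr mulrA mulrC ler_wpM2r.
lra.
Qed.

(** The failure of [1 - sqrt_poly n] to be a square root of [1 - B] is one step of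
    the iteration, which is geometrically small. *)
Lemma sqr_sub_sqrt_poly n x :
  poly_op B (1 - sqrt_poly n) (poly_op B (1 - sqrt_poly n) x) - (x - B x) =
  2 *: (Y n.+1 x - Y n x).
Proof.
rewrite -poly_opM.
have -> : (1 - sqrt_poly n) * (1 - sqrt_poly n) =
    1 + (-1) *: 'X + 2 *: (sqrt_poly n.+1 + (-1) *: sqrt_poly n) :> {poly R[i]}.
  by rewrite /= scalerDr scalerA mulfV// !scaleN1r scale1r scalerN scaler_nat; ring.
move: (sqrt_poly n.+1) (sqrt_poly n) => p r.
rewrite !poly_opD !poly_opZ poly_op1 poly_opD poly_opZ poly_opX !scaleN1r.
by rewrite addrC addKr.
Qed.

End Bounds.

(** The two numbers have nearly the same square, [l], and their sum stays away
    from 0 since the real part of [gamma l] is nonnegative and that of the other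
    one is at least [sqrt a * (1 - s)]; so their difference is small. *)
Lemma gamma_approx (a rho s : R) (l : R[i]^o) n : 0 < a -> 0 <= s < 1 ->
  rho + s ^+ 2 <= s *+ 2 -> rnorm (coord a l) = rho ->
  rnorm (gamma l - (Num.sqrt a)%:C * (1 - sqrt_poly n).[coord a l] : R[i]^o) <=
    Num.sqrt a * (2 * s / (1 - s)) * s ^+ n.
Proof.
move=> a0 /andP[s0 s1] rs lr.
have B_le (x : R[i]^o) : rnorm (GRing.scale (coord a l : R[i]) x) <= rho * rnorm x.
  by rewrite rnormZ lr.
set M : {linear R[i]^o -> R[i]^o} := GRing.scale (coord a l : R[i]).
set w := (1 - sqrt_poly n).[coord a l].
have wE : w = 1 - (sqrt_poly n).[coord a l] by rewrite /w hornerD hornerN hornerC.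
have ReW : 1 - s <= complex.Re w.
  have := @sqrt_poly_le R[i]^o M _ _ B_le s0 rs n 1.
  rewrite poly_op_mul rnorm1 mulr1 => h.
  have := le_trans (Re_le_rnorm _) h; rewrite wE.
  by case: (sqrt_poly n).[_] => x y /=; rewrite ler_norml => /andP[]; lra.
have sw : rnorm (w * w - (1 - coord a l) : R[i]^o) <= 2 * s * s ^+ n.
  have := @sqrt_poly_step R[i]^o M _ _ B_le s0 rs n 1.
  have := @sqr_sub_sqrt_poly R[i]^o M n 1.
  rewrite -poly_opM !poly_op_mul hornerM -/w.
  rewrite (_ : M 1 = coord a l); last exact: mulr1.
  rewrite /= => -> h; rewrite rnormZ rnorm_nat.
  by rewrite -mulrA ler_wpM2l// (le_trans h)// rnorm1 mulr1.
set g := (Num.sqrt a)%:C.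
have gg : g * g = a%:C by rewrite -rmorphM/= -expr2 sqr_sqrtr// ltW.
have diff : (gamma l - g * w) * (gamma l + g * w) =
    - a%:C * (w * w - (1 - coord a l)).
  have : gamma l * gamma l = a%:C * (1 - coord a l) by rewrite gamma_sqr coordK.
  by move=> h; rewrite -gg in h *; rewrite -subr_sqr expr2 h; ring.
have lower : Num.sqrt a * (1 - s) <= rnorm (gamma l + g * w : R[i]^o).
  apply: le_trans (Re_le_rnorm _); apply: le_trans (ler_norm _).
  move: (gamma l) (Re_gamma_ge0 l) w ReW {wE sw diff} => [x y] /= x0 [u v] /= u0.
  by rewrite mul0r subr0 ler_wpDl// ler_wpM2l// sqrtr_ge0.
have r0 : 0 < Num.sqrt a by rewrite sqrtr_gt0.
have s1' : 0 < 1 - s by rewrite subr_gt0.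
rewrite -(ler_pM2r (mulr_gt0 r0 s1')).
apply: le_trans (ler_wpM2l (rnorm_ge0 _) lower) _.
rewrite -rnormM diff rnormM -rmorphN/= rnormR normrN gtr0_norm//.
apply: le_trans (ler_wpM2l (ltW a0) sw) _.
rewrite -{1}(sqr_sqrtr (ltW a0)) -subr_ge0 [X in 0 <= X](_ : _ = 0)//.
by field; rewrite gt_eqF.
Qed.

End SqrtPoly.

(** * Operators on a Hilbert space *)

Section Hilbert.
Context {R : realType} {H : normedModType R[i]}.
Local Open Scope complex_scope.
Local Open Scope ring_scope.
Variable dot : {dot H for (@Num.conj R[i])}.
Hypothesis norm_dot : forall x : H, `|x| ^+ 2 = dot x x.
Implicit Types (x y : H).

Local Notation re x y := (complex.Re (dot x y)).

Lemma dot_conj x y : dot x y = (dot y x)^*%C.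
Proof. by rewrite hermC expr0 mul1r. Qed.

Lemma re_dotC x y : re x y = re y x.
Proof. by rewrite dot_conj; case: (dot y x). Qed.

Lemma re_dotDl x y z : re (x + y) z = re x z + re y z.
Proof. by rewrite linearDl/=; case: (dot x z) (dot y z) => [? ?] [? ?]. Qed.

Lemma re_dotDr x y z : re z (x + y) = re z x + re z y.
Proof. by rewrite re_dotC re_dotDl !(re_dotC z). Qed.

Lemma re_dotZl (k : R) x y : re (k%:C *: x) y = k * re x y.
Proof. by rewrite linearZl_LR/=; case: (dot x y) => u v /=; rewrite mul0r subr0. Qed.

Lemma re_dotZr (k : R) x y : re y (k%:C *: x) = k * re y x.
Proof. by rewrite re_dotC re_dotZl re_dotC. Qed.

Lemma dotZr_real (k : R) x y : dot x (k%:C *: y) = k%:C * dot x y.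
Proof. by rewrite linearZr_LR/=; congr (_ * _); exact: conjc_real. Qed.

Lemma sqr_rnorm_dot x : rnorm x ^+ 2 = re x x.
Proof. by rewrite -norm_dot normE -rmorphXn. Qed.

Lemma re_dot_le x y : re x y <= rnorm x * rnorm y.
Proof.
have [->|x0] := eqVneq x 0; first by rewrite linear0l rnorm0 mul0r.
have [->|y0] := eqVneq y 0; first by rewrite linear0r rnorm0 mulr0.
have : 0 < rnorm x * rnorm y by rewrite mulr_gt0// rnorm_gt0.
(* this square is [2 * X * Y * (X * Y - c)] in the notation of the last line *)
have : 0 <= rnorm ((rnorm y)%:C *: x + (- rnorm x)%:C *: y) ^+ 2 by exact: sqr_ge0.
rewrite sqr_rnorm_dot !re_dotDl !re_dotDr !re_dotZl !re_dotZr -!sqr_rnorm_dot.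
rewrite (re_dotC y x); move: (re x y) (rnorm x) (rnorm y) => c X Y; nra.
Qed.

Lemma rnorm_dot_le x y : rnorm (dot x y : R[i]^o) <= rnorm x * rnorm y.
Proof.
set z := dot x y; have [->|z0] := eqVneq (rnorm (z : R[i]^o)) 0.
  by rewrite mulr_ge0 ?rnorm_ge0.
have zp : 0 < rnorm (z : R[i]^o) by rewrite lt_def z0 rnorm_ge0.
rewrite -(ler_pM2l zp) mulrA.
(* multiplying [x] by the conjugate of [z] makes the inner product real *)
have -> : rnorm (z : R[i]^o) * rnorm (z : R[i]^o) = re (z^*%C *: x) y.
  rewrite linearZl_LR/= -/z -expr2 sqr_rnorm; case: z {z0 zp} => u v /=; ring.
apply: le_trans (re_dot_le _ _) _; rewrite rnormZ.
by rewrite /rnorm normcJ.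
Qed.

Lemma self_adjoint_Im A x : self_adjoint dot A -> complex.Im (dot (A x) x) = 0.
Proof.
move=> /(_ x x); rewrite [RHS]dot_conj; case: (dot (A x) x) => u v [] /=; lra.
Qed.

Lemma dot_ge0E A x : self_adjoint dot A -> (0 <= dot (A x) x) = (0 <= re (A x) x).
Proof. by move=> /(self_adjoint_Im x) h; rewrite lecE h eqxx. Qed.

(** Let [|L x| <= M |x|].  For [y = x - L x / M], the inequality [0 <= <L y, y>]
    gives [|L x| ^ 2 <= M <L x, x>]; then the expansion of [|x - L x / M| ^ 2] is
    at most [|x| ^ 2 - |L x| ^ 2 / M ^ 2], where [|L x|] is at least a constant
    times [|x|] because [L] has a bounded inverse. *)
Lemma GLSplus_contraction (L : H -> H) : GLSplus dot L ->
  exists a q : R, [/\ 0 < a, 0 <= q, q < 1 &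
    forall x, rnorm (x - (a^-1)%:C *: L x) <= q * rnorm x].
Proof.
move=> [[[Llin [M0 LM0]] Lsa Lpos] [_ [A [[_ [K0 AK0]] LA _]]]].
pose M := Num.max M0 1; pose K := Num.max K0 1.
have M1 : 1 <= M by rewrite le_max lexx orbT.
have K1 : 1 <= K by rewrite le_max lexx orbT.
have Mp : 0 < M by apply: lt_le_trans M1.
have Kp : 0 < K by apply: lt_le_trans K1.
have LM x : rnorm (L x) <= M * rnorm x.
  by apply: le_trans (LM0 x) _; rewrite ler_wpM2r ?rnorm_ge0// le_max lexx.
have LK x : rnorm x <= K * rnorm (L x).
  rewrite -{1}(LA x); apply: le_trans (AK0 _) _.
  by rewrite ler_wpM2r ?rnorm_ge0// le_max lexx.
have Lge0 x : 0 <= re (L x) x.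
  rewrite -dot_ge0E//; have [->|x0] := eqVneq x 0; first by rewrite linear0r.
  pose k := (rnorm x)^-1; have k0 : 0 < k by rewrite invr_gt0 rnorm_gt0.
  have := Lpos (k%:C *: x); rewrite normE rnormZ rnormR gtr0_norm// mulVf ?rnorm_eq0//.
  move=> /(_ erefl)/ltW; rewrite !dot_ge0E//.
  by rewrite (linear_scale Llin) re_dotZl re_dotZr !pmulr_rge0.
pose m := M^-1; have mp : 0 < m by rewrite invr_gt0.
have mM : m * M = 1 by rewrite mulVf// gt_eqF.
have key x : m * rnorm (L x) ^+ 2 <= re (L x) x.
  have := Lge0 (x + (- m)%:C *: L x).
  have -> : L (x + (- m)%:C *: L x) = L x + (- m)%:C *: L (L x).
    by rewrite addrC Llin addrC.
  rewrite !re_dotDl !re_dotDr !re_dotZl !re_dotZr.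
  have -> : re (L (L x)) x = rnorm (L x) ^+ 2 by rewrite Lsa sqr_rnorm_dot.
  rewrite -sqr_rnorm_dot.
  have : re (L (L x)) (L x) <= M * rnorm (L x) ^+ 2.
    by apply: le_trans (re_dot_le _ _) _; rewrite expr2 mulrA ler_wpM2r ?rnorm_ge0.
  move: (re (L (L x)) (L x)) (re (L x) x) (rnorm (L x) ^+ 2) => u v w h1.
  have : m * (m * u) <= m * w.
    by rewrite ler_pM2l// -(ler_pM2l Mp) mulrA (mulrC M) mM mul1r.
  lra.
pose k := K^-1; have kp : 0 < k by rewrite invr_gt0.
have km1 : 0 <= (m * k) ^+ 2 <= 1.
  rewrite sqr_ge0/= expr_le1// ?mulr_ge0 ?(ltW mp) ?(ltW kp)//.
  by rewrite mulr_ile1 ?(ltW mp) ?(ltW kp)// invf_le1.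
exists M, (Num.sqrt (1 - (m * k) ^+ 2)); split => //.
  rewrite -[ltRHS]sqrtr1 ltr_sqrt// ltrBlDr ltrDl exprn_gt0// mulr_gt0//.
move=> x; rewrite -/m.
rewrite -(@ler_pXn2r _ 2)// ?nnegrE ?mulr_ge0 ?rnorm_ge0 ?sqrtr_ge0//.
rewrite exprMn sqr_sqrtr; last by lra.
have -> : x - m%:C *: L x = x + (- m)%:C *: L x by rewrite rmorphN scaleNr.
rewrite sqr_rnorm_dot !re_dotDl !re_dotDr !re_dotZl !re_dotZr (re_dotC x (L x)).
rewrite -!sqr_rnorm_dot.
have h1 := key x.
have h2 : (k * rnorm x) ^+ 2 <= rnorm (L x) ^+ 2.
  rewrite lerXn2r ?nnegrE ?mulr_ge0 ?rnorm_ge0 ?(ltW kp)//.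
  by rewrite ler_pdivrMl.
have h3 : m * (k * rnorm x) ^+ 2 <= m * rnorm (L x) ^+ 2 by rewrite ler_pM2l.
move: h1 h2 h3; rewrite !exprMn.
move: (rnorm (L x) ^+ 2) (rnorm x ^+ 2) (re (L x) x) (k ^+ 2) => u v w t h1 h2 h3.
have h4 : m * (m * u) <= m * w by rewrite ler_pM2l.
have h5 : m * (m * (t * v)) <= m * (m * u) by rewrite ler_pM2l.
nra.
Qed.

End Hilbert.

(** * The positive square root as a limit of polynomials *)

Section SqrtLimit.
Context {R : realType} {H : completeNormedModType R[i]}.
Local Open Scope complex_scope.
Local Open Scope ring_scope.
Variables (B : {linear H -> H}) (q s : R).
Hypotheses (B_le : forall x, rnorm (B x) <= q * rnorm x).
Hypotheses (s01 : 0 <= s < 1) (qs : q + s ^+ 2 <= s *+ 2).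
Local Notation T n := (poly_op B (1 - sqrt_poly n)).

Let s0 : 0 <= s. Proof. by case/andP: s01. Qed.
Let s1 : 0 < 1 - s. Proof. by rewrite subr_gt0; case/andP: s01. Qed.

Lemma sub_sqrt_polyE n x : T n x = x - poly_op B (sqrt_poly n) x.
Proof. by rewrite poly_opD -(scaleN1r (sqrt_poly n)) poly_opZ poly_op1 scaleN1r. Qed.

Lemma sub_sqrt_poly_le n x : rnorm (T n x) <= 2 * rnorm x.
Proof.
rewrite sub_sqrt_polyE; apply: le_trans (rnormD _ _) _; rewrite rnormN.
rewrite [2 * _]mulrDl mul1r lerD2l; apply: le_trans (sqrt_poly_le B_le s0 qs n x) _.
by rewrite ler_piMl ?rnorm_ge0// ltW//; case/andP: s01.
Qed.

Lemma sqrt_limit : exists P : H -> H, linear P /\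
  forall n x, rnorm (P x - T n x) <= s / (1 - s) * rnorm x * s ^+ n.
Proof.
have ex x : exists l : H, forall n, rnorm (l - T n x) <= s / (1 - s) * rnorm x * s ^+ n.
  have [|n|l Hl] := @geometric_limit R H (s * rnorm x) s (fun n => T n x) _ s01.
  - by rewrite mulr_ge0// rnorm_ge0.
  - rewrite !sub_sqrt_polyE subrACA subrr sub0r rnormN.
    exact: sqrt_poly_step B_le s0 qs n x.
  by exists l => n; rewrite (mulrAC s); exact: Hl.
have [P HP] := choice ex; exists P; split; last by move=> n x; exact: HP.
move=> k x y; apply/eqP; rewrite -subr_eq0; apply/eqP.
pose C := s / (1 - s).
apply: (@geometric_eq0 R H (C * rnorm (k *: x + y) +
  (rnorm (k : R[i]^o) * (C * rnorm x) + C * rnorm y)) s) => // n.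
have -> : P (k *: x + y) - (k *: P x + P y) =
    (P (k *: x + y) - T n (k *: x + y)) - (k *: (P x - T n x) + (P y - T n y)).
  by rewrite poly_op_linear scalerBr addrACA -opprD subrACA subrr subr0.
apply: le_trans (rnormD _ _) _; rewrite rnormN [leRHS]mulrDl lerD ?HP//.
apply: le_trans (rnormD _ _) _; rewrite rnormZ [leRHS]mulrDl lerD ?HP//.
by rewrite -[leRHS]mulrA ler_wpM2l ?rnorm_ge0 ?HP.
Qed.

Variable P : H -> H.
Hypothesis P_lim :
  forall n x, rnorm (P x - T n x) <= s / (1 - s) * rnorm x * s ^+ n.

(** [P] is the common limit of the [T n], which are within [s] of the identity. *)
Lemma sqrt_limit_near_id x : rnorm (x - P x) <= s * rnorm x.
Proof.
apply/ler_addgt0Pr => e e0.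
have [n /(_ n (leqnn _)) Hn] := geometric_le (s / (1 - s) * rnorm x) s01 e0.
apply: le_trans (rnormDB (T n x) _ _) _; apply: lerD.
  by rewrite sub_sqrt_polyE opprB addrC subrK; exact: sqrt_poly_le B_le s0 qs n x.
by rewrite rnormB; apply: le_trans (P_lim n x) Hn.
Qed.

Lemma sqrt_limit_sqr x : P (P x) = x - B x.
Proof.
apply/eqP; rewrite -subr_eq0; apply/eqP; pose C := s / (1 - s).
apply: (@geometric_eq0 R H (C * rnorm (P x) + (2 * (C * rnorm x) + 2 * (s * rnorm x))) s)
  => // n.
have -> : P (P x) - (x - B x) = (P (P x) - T n (P x)) +
    (T n (P x - T n x) + (T n (T n x) - (x - B x))).
  by rewrite (linear_sub (poly_op_linear B _)) !addrA !subrK.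
apply: le_trans (rnormD _ _) _; rewrite [leRHS]mulrDl lerD ?P_lim//.
apply: le_trans (rnormD _ _) _; rewrite [leRHS]mulrDl lerD//.
  apply: le_trans (sub_sqrt_poly_le _ _) _; rewrite -[leRHS]mulrA.
  by rewrite ler_wpM2l// P_lim.
rewrite sqr_sub_sqrt_poly rnormZ rnorm_nat -mulrA ler_wpM2l//.
exact: sqrt_poly_step B_le s0 qs n x.
Qed.

(** This is what makes [P] commute with every square root of [1 - B]. *)
Lemma sqrt_limit_commute (S : {linear H -> H}) (M : R) :
  (forall x, rnorm (S x) <= M * rnorm x) ->
  (forall x, S (B x) = B (S x)) -> forall x, S (P x) = P (S x).
Proof.
move=> SM SB x; apply/eqP; rewrite -subr_eq0; apply/eqP; pose C := s / (1 - s).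
apply: (@geometric_eq0 R H (`|M| * (C * rnorm x) + C * rnorm (S x)) s) => // n.
have -> : S (P x) - P (S x) = S (P x - T n x) - (P (S x) - T n (S x)).
  by rewrite (linearB S)/= (poly_op_commute _ _ SB) opprB addrA subrK.
apply: le_trans (rnormD _ _) _; rewrite rnormN [leRHS]mulrDl lerD ?P_lim//.
apply: le_trans (SM _) _; apply: le_trans (ler_wpM2r (rnorm_ge0 _) (ler_norm M)) _.
by rewrite -[leRHS]mulrA ler_wpM2l// P_lim.
Qed.

Variable dot : {dot H for (@Num.conj R[i])}.
Hypothesis norm_dot : forall x : H, `|x| ^+ 2 = dot x x.
Local Notation re x y := (complex.Re (dot x y)).

(** [<P x, x> = |x| ^ 2 - <x - P x, x>], and [x - P x] is at most [s |x|]. *)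
Lemma sqrt_limit_coercive x : (1 - s) * rnorm x ^+ 2 <= re (P x) x.
Proof.
have := re_dot_le norm_dot (x - P x) x.
have : re x x = re (x - P x) x + re (P x) x by rewrite -re_dotDl subrK.
rewrite -(sqr_rnorm_dot norm_dot) => e h.
have := ler_wpM2r (rnorm_ge0 x) (sqrt_limit_near_id x).
by rewrite -mulrA -expr2; lra.
Qed.

Lemma sqrt_poly_self_adjoint n : self_adjoint dot B ->
  self_adjoint dot (poly_op B (sqrt_poly n)).
Proof.
move=> Bsa; elim: n => [|n IH] x y; first by rewrite !poly_op0 linear0l linear0r.
rewrite !sqrt_polyS linearZl_LR linearZr_LR/= linearDl linearDr/= Bsa !IH.
by rewrite fmorphV rmorph_nat (linearDr dot) mulrDr.
Qed.

Lemma sqrt_limit_self_adjoint : self_adjoint dot B -> self_adjoint dot P.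
Proof.
move=> Bsa x y; apply/eqP; rewrite -subr_eq0; apply/eqP; pose C := s / (1 - s).
apply: (@geometric_eq0 R R[i]^o (C * rnorm x * rnorm y + rnorm x * (C * rnorm y)) s) => // n.
have e : dot (T n x) y = dot x (T n y).
  by rewrite !sub_sqrt_polyE linearBl linearBr/= sqrt_poly_self_adjoint.
have -> : dot (P x) y - dot x (P y) = dot (P x - T n x) y - dot x (P y - T n y).
  by rewrite (linearBl dot) (linearBr dot)/= e subrACA subrr subr0.
apply: le_trans (rnormD _ _) _; rewrite rnormN [leRHS]mulrDl.
apply: lerD; apply: le_trans (rnorm_dot_le norm_dot _ _) _.
  by rewrite mulrAC ler_wpM2r ?rnorm_ge0 ?P_lim.
by rewrite -[leRHS]mulrA ler_wpM2l ?rnorm_ge0 ?P_lim.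
Qed.

End SqrtLimit.

(** * Operator norm and resolvent *)

Section Resolvent.
Context {R : realType} {H : normedModType R[i]}.
Local Open Scope complex_scope.
Local Open Scope ring_scope.

Lemma op_norm_leP (A : H -> H) (e : R) :
  (op_norm A <= e%:E)%E <-> forall x, rnorm x <= 1 -> rnorm (A x) <= e.
Proof.
split=> [Ae x x1|h].
  rewrite -lee_fin; apply: le_trans Ae.
  by apply: ereal_sup_ubound; exists x.
by apply: ge_ereal_sup => _ [x /= x1 <-]; rewrite lee_fin h.
Qed.

Lemma op_norm_le (A : H -> H) (e : R) : 0 <= e ->
  (forall x, rnorm (A x) <= e * rnorm x) -> (op_norm A <= e%:E)%E.
Proof.
by move=> e0 h; apply/op_norm_leP => x x1; apply: le_trans (h x) _; rewrite ler_piMr.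
Qed.

Lemma op_norm_is_ext_norm : is_ext_norm (@op_norm R H).
Proof.
split=> [|A A' e e' /op_norm_leP h /op_norm_leP h'|k A e /op_norm_leP h].
- by apply/op_norm_leP => x _; rewrite rnorm0.
- apply/op_norm_leP => x x1; apply: le_trans (rnormD _ _) _.
  by rewrite lerD ?h ?h'.
- by apply/op_norm_leP => x x1; rewrite rnormZ ler_wpM2l ?rnorm_ge0 ?h.
Qed.

Lemma inv_opE (A A' : H -> H) : is_inverse_op A A' -> inv_op A = A'.
Proof.
move=> AA'; rewrite /inv_op; case: xgetP => [A'' _ [_ h _]|/(_ A')//].
by have [_ _ h'] := AA'; apply/funext => x; rewrite -{1}(h' x) h.
Qed.

Lemma is_inverse_opZ (A A' : H -> H) (k : R[i]) : k != 0 -> linear A ->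
  is_inverse_op A A' -> is_inverse_op (k *: A) (k^-1 *: A').
Proof.
move=> k0 Alin [[A'lin [M A'M]] AA' A'A].
split.
- split=> [z x y|].
    by rewrite /= !fctE /= A'lin scalerDr !scalerA mulrC.
  exists (rnorm (k^-1 : R[i]^o) * M) => x.
  by rewrite rnormZ -mulrA ler_wpM2l ?rnorm_ge0.
- by move=> x; rewrite !fctE (linear_scale A'lin) AA' scalerA mulVf// scale1r.
- by move=> x; rewrite !fctE (linear_scale Alin) A'A scalerA mulfV// scale1r.
Qed.

End Resolvent.

Section ContractionResolvent.
Context {R : realType} {H : completeNormedModType R[i]}.
Local Open Scope complex_scope.
Local Open Scope ring_scope.
Variables (B : {linear H -> H}) (L : H -> H) (a q : R).
Hypotheses (a_gt0 : 0 < a) (q_ge0 : 0 <= q).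
Hypotheses (BE : forall x, B x = x - (a^-1)%:C *: L x)
  (B_le : forall x, rnorm (B x) <= q * rnorm x).

Let aC : a%:C != 0 :> R[i].
Proof. by rewrite realC_eq0 gt_eqF. Qed.

Lemma sub_scalar_coord (l : R[i]) :
  L - l *: idfun = a%:C *: ((coord a l : R[i]) *: idfun - (B : H -> H)).
Proof.
have e : a%:C * coord a l = a%:C - l by rewrite -{2}(coordK a_gt0 l); ring.
apply/funext => x; rewrite !fctE /= BE !scalerBr !scalerA e fmorphV/= mulfV//.
by rewrite scale1r scalerBl subrACA subrr sub0r opprB.
Qed.

Lemma sub_coord_bounded (m : R[i]) : bounded_op (m *: idfun - (B : H -> H)).
Proof.
split=> [k x y|].
  by rewrite !fctE (linearP B)/= scalerDr scalerBr opprD addrACA !scalerA mulrC.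
exists (rnorm (m : R[i]^o) + q) => x.
by apply: le_trans (rnormD _ _) _; rewrite rnormN rnormZ mulrDl lerD.
Qed.

(** The Neumann series in [B], transported to [L] by [L - l = a (coord l - B)]. *)
Lemma contraction_resolvent (l : R[i]^o) : q < rnorm (coord a l) ->
  isomorphism_op (L - (l : R[i]) *: idfun) /\
  forall n, (op_norm (a%:C *: resolvent L l -
      \sum_(k < n) (coord a l ^- k.+1 : R[i]) *: (iter k B : H -> H))%R <=
    ((rnorm (coord a l) - q)^-1 * (q / rnorm (coord a l)) ^+ n)%:E)%E.
Proof.
move=> ql; have [A [Ainv Aerr]] := neumann_inverse q_ge0 B_le ql.
have [Blin [M BM]] := sub_coord_bounded (coord a l).
have inv : is_inverse_op (L - (l : R[i]) *: idfun) ((a%:C)^-1 *: A).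
  by rewrite sub_scalar_coord; apply: is_inverse_opZ.
split.
  split; last by exists ((a%:C)^-1 *: A).
  rewrite sub_scalar_coord; split=> [k x y|].
    by have := Blin k x y; rewrite !fctE => ->; rewrite scalerDr !scalerA mulrC.
  exists (a * M) => x.
  by rewrite rnormZ rnormR gtr0_norm// -mulrA ler_wpM2l// ltW.
move=> n; rewrite /resolvent (inv_opE inv) scalerA mulfV// scale1r.
apply: op_norm_le => [|x].
  by rewrite mulr_ge0 ?invr_ge0 ?subr_ge0 ?exprn_ge0 ?divr_ge0 ?rnorm_ge0// ltW.
by have := Aerr n x; rewrite !fctE fct_sumE.
Qed.

Lemma spectrum_contraction (l : R[i]^o) : spectrum L l -> rnorm (coord a l) <= q.
Proof. by rewrite leNgt => h; apply/negP => /contraction_resolvent[/h]. Qed.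

(** Cauchy's formula for polynomials; [a (L - l)^-1] is the inverse of
    [coord l - B], and the factor [- a] is that of [dl] with respect to [coord l]. *)
Lemma circle_integral_resolvent (rho : R) (p : {poly R[i]}) : q < rho ->
  is_op_integral (circle a rho)
    (fun l => p.[coord a l] *: (a%:C *: resolvent L l))
    (- (two_pi_i R * a%:C) *: poly_op B p).
Proof.
move=> qr; have r0 : 0 < rho by apply: le_lt_trans qr.
have mono j : is_op_integral (circle a rho)
    (fun l => (coord a l ^+ j : R[i]) *: (a%:C *: resolvent L l))
    (- (two_pi_i R * a%:C) *: (iter j B : H -> H)).
  apply: (circle_integral_geometric a_gt0 r0 (q := q) (C := (rho - q)^-1) j
    op_norm_is_ext_norm (v := fun k => (iter k B : H -> H))).
  - by rewrite q_ge0 qr.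
  - move=> k; apply: op_norm_le; first by rewrite exprn_ge0.
    by move=> x; exact: (iter_le q_ge0 B_le).
  move=> l m lr; rewrite -lr; apply: (contraction_resolvent _).2.
  by rewrite lr.
have := path_integral_sum op_norm_is_ext_norm (size p)
  (fun i => path_integralZ op_norm_is_ext_norm p`_i (mono i)).
rewrite /is_op_integral; congr is_path_integral.
- apply/funext => l; rewrite horner_coef scaler_suml.
  by apply: eq_bigr => i _; rewrite !scalerA mulrA.
- rewrite /poly_op scaler_sumr; apply: eq_bigr => i _.
  by rewrite !scalerA mulrC.
Qed.

End ContractionResolvent.

(** * The square root as a Cauchy integral *)

Section SqrtIntegral.
Context {R : realType} {H : completeNormedModType R[i]}.
Local Open Scope complex_scope.
Local Open Scope ring_scope.

Lemma coord_disc_Theta (a : R) (l : R[i]^o) : 0 < a -> rnorm (coord a l) < 1 -> Theta l.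
Proof.
move=> a0 l1; rewrite /Theta /= -(coordK a0 l).
have := le_lt_trans (Re_le_rnorm _) l1; rewrite ltr_norml => /andP[_].
by case: (coord a l) => u v /= u1; rewrite mul0r subr0 mulr_gt0// subr_gt0.
Qed.

Variable dot : {dot H for (@Num.conj R[i])}.
Hypothesis norm_dot : forall x : H, `|x| ^+ 2 = dot x x.

(** If [S] is another nonnegative root and [y = S x - T x], then [S y + T y = 0],
    because [S] and [T] commute and have the same square; so the nonnegative
    numbers [<S y, y>] and [<T y, y>] vanish, and [y = 0] by coercivity of [T]. *)
Lemma sqrt_op_unique (L T : H -> H) (k : R) : 0 < k ->
  nonneg_op dot T -> T \o T = L ->
  (forall x, k * rnorm x ^+ 2 <= complex.Re (dot (T x) x)) ->
  (forall S, nonneg_op dot S -> S \o S = L -> forall x, S (T x) = T (S x)) ->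
  sqrt_op dot L = T.
Proof.
move=> k0 Tnn TT Tk comm; rewrite /sqrt_op.
case: xgetP => [S _ [Snn SS]|/(_ T)]; last by case; split.
apply/funext => x; apply/eqP; rewrite -subr_eq0 -rnorm_eq0 -sqrf_eq0.
have [[Slin _] _ Sge0] := Snn; have [[Tlin _] _ _] := Tnn.
set y := S x - T x.
have STy : S y + T y = 0.
  rewrite /y (linear_sub Slin) (linear_sub Tlin) comm// subrKA.
  by rewrite -[S (S x)]/((S \o S) x) -[T (T x)]/((T \o T) x) SS TT subrr.
have : complex.Re (dot (S y) y) + complex.Re (dot (T y) y) = 0.
  by rewrite -re_dotDl STy linear0l.
have := Tk y; have : 0 <= complex.Re (dot (S y) y).
  by have := Sge0 y; rewrite lecE => /andP[].
have := sqr_ge0 (rnorm y); rewrite eq_le => -> h1 h2 h3; rewrite andbT.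
by rewrite -(pmulr_rle0 _ k0); lra.
Qed.

(** On the circle [gamma] is the uniform limit of [sqrt a * (1 - sqrt_poly n)] in
    [coord l], and the square root of [L] is the limit in norm of the same
    polynomials in [B]; the two sides correspond by integration against the
    resolvent. *)
Lemma GLSplus_sqrt_integral (L : H -> H) : GLSplus dot L ->
  exists c : R -> R[i]^o,
    [/\ closed_path c, path_image c `|` path_interior c `<=` @Theta R,
        spectrum L `<=` path_interior c
      & is_cauchy_integral (@gamma R) L c (sqrt_op dot L)].
Proof.
move=> LGL; have [a [q [a0 q0 q1 LB]]] := GLSplus_contraction norm_dot LGL.
have [[[Llin [M LM]] Lsa Lpos] _] := LGL.
have Blin : linear (fun x => x - (a^-1)%:C *: L x).
  move=> k x y /=.
  by rewrite Llin scalerDr opprD addrACA scalerBr !scalerA mulrC.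
pose B : {linear H -> H} :=
  HB.pack (fun x => x - (a^-1)%:C *: L x) (GRing.isLinear.Build _ _ _ _ _ Blin).
have BE x : B x = x - (a^-1)%:C *: L x by [].
have B_le x : rnorm (B x) <= q * rnorm x by exact: LB.
pose rho := (q + 1) / 2.
have qr : q < rho by rewrite /rho; lra.
have r0 : 0 < rho by apply: le_lt_trans qr.
have r1 : rho < 1 by rewrite /rho; lra.
(* the fixed point of [y |-> (rho + y ^ 2) / 2] in [0, 1[ *)
pose s := 1 - Num.sqrt (1 - rho).
have rs : rho + s ^+ 2 <= s *+ 2.
  have e : Num.sqrt (1 - rho) ^+ 2 = 1 - rho by rewrite sqr_sqrtr; lra.
  rewrite /s; move: (Num.sqrt _) e => t e; nra.
have s01 : 0 <= s < 1.
  rewrite /s subr_ge0 ltrBlDr ltrDl sqrtr_gt0 subr_gt0 r1 andbT.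
  rewrite -[leRHS]sqrtr1 ler_wsqrtr//; lra.
have qs : q + s ^+ 2 <= s *+ 2 by apply: le_trans rs; rewrite lerD2r ltW.
have [P [Plin P_lim]] := sqrt_limit B_le s01 qs.
have sa0 : 0 < Num.sqrt a by rewrite sqrtr_gt0.
pose T : H -> H := (Num.sqrt a)%:C *: P.
have TE x : T x = (Num.sqrt a)%:C *: P x by [].
have Bsa : self_adjoint dot B.
  move=> x y; rewrite !BE (linearBl dot) (linearBr dot)/=.
  by rewrite linearZl_LR dotZr_real/= Lsa.
have Psa := sqrt_limit_self_adjoint s01 P_lim norm_dot Bsa.
have Tsa : self_adjoint dot T.
  by move=> x y; rewrite !TE linearZl_LR dotZr_real/= Psa.
have s1 : 0 < 1 - s by rewrite subr_gt0; case/andP: s01.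
have Tk x : Num.sqrt a * (1 - s) * rnorm x ^+ 2 <= complex.Re (dot (T x) x).
  rewrite TE re_dotZl -mulrA ler_wpM2l ?(ltW sa0)//.
  exact: (sqrt_limit_coercive B_le s01 qs P_lim norm_dot).
have Tlin : linear T.
  by move=> k x y; rewrite !TE Plin scalerDr !scalerA mulrC.
have Tnn : nonneg_op dot T.
  split=> //; last first.
    move=> x; rewrite dot_ge0E//; apply: le_trans (Tk x).
    by rewrite mulr_ge0 ?sqr_ge0// mulr_ge0 ?(ltW s1) ?(ltW sa0).
  split=> //; exists (Num.sqrt a * (1 + s)) => x.
  rewrite TE rnormZ rnormR gtr0_norm// -mulrA ler_wpM2l ?(ltW sa0)//.
  rewrite mulrDl mul1r; apply: le_trans (rnorm_le_sub _ x) _.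
  by rewrite lerD2l rnormB; exact: (sqrt_limit_near_id B_le s01 qs P_lim).
have saa : (Num.sqrt a)%:C * (Num.sqrt a)%:C = a%:C.
  by rewrite -rmorphM/= -expr2 sqr_sqrtr// ltW.
have aC : a%:C != 0 :> R[i] by rewrite realC_eq0 gt_eqF.
have TT : T \o T = L.
  apply/funext => x /=; rewrite !TE.
  rewrite (linear_scale Plin) (sqrt_limit_sqr B_le s01 qs P_lim) BE scalerA saa.
  rewrite opprB addrC subrK.
  by rewrite scalerA fmorphV/= mulfV// scale1r.
have sqrtE : sqrt_op dot L = T.
  apply: (sqrt_op_unique _ Tnn TT Tk); first by rewrite mulr_gt0.
  move=> S [[Slin [N SN]] _ _] SS x.
  pose S' : {linear H -> H} := HB.pack S (GRing.isLinear.Build _ _ _ _ _ Slin).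
  have SL y : S (L y) = L (S y) by rewrite -SS.
  have S'B y : S' (B y) = B (S' y).
    by rewrite !BE (linearB S') linearZ/= SL.
  rewrite !TE -[S _]/(S' _) linearZ/=; congr (_ *: _).
  exact: (@sqrt_limit_commute _ _ _ _ s01 _ P_lim S' _ SN S'B).
exists (circle a rho).
have interior_lt l : path_interior (circle a rho) l <-> rnorm (coord a l) < rho.
  exact: path_interior_circle.
split.
- exact: circle_closed_path.
- move=> l [/(path_image_circle a0 r0)|/interior_lt] h; apply: (coord_disc_Theta a0).
    by rewrite h.
  exact: lt_trans h r1.
- move=> l /(spectrum_contraction a0 q0 BE B_le) h.
  exact/interior_lt/(le_lt_trans h qr).
have pi0 : two_pi_i R != 0.
  rewrite /two_pi_i mulf_neq0 ?neq0Ci// realC_eq0.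
  by rewrite mulrn_eq0/= gt_eqF// pi_gt0.
rewrite sqrtE; exists (- two_pi_i R *: T); last first.
  by rewrite scalerA mulrNN mulVf// scale1r.
apply: (path_integral_lim op_norm_is_ext_norm (circle_length a0 r0)) => e e0.
pose D := (rho - q)^-1.
have D0 : 0 <= D by rewrite invr_ge0 subr_ge0 ltW.
have resD l : rnorm (coord a l) = rho -> (op_norm (a%:C *: resolvent L l) <= D%:E)%E.
  move=> lr; have := (contraction_resolvent a0 q0 BE B_le (l := l)).
  by rewrite lr => /(_ qr)[_ /(_ 0%N)]; rewrite big_ord0 subr0 mulr1.
pose C1 := a^-1 * (Num.sqrt a * (2 * s / (1 - s))) * D.
pose C2 := rnorm (two_pi_i R : R[i]^o) * Num.sqrt a * (s / (1 - s)).
have [n1 Hn1] := geometric_le C1 s01 e0; have [n2 Hn2] := geometric_le C2 s01 e0.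
pose n := maxn n1 n2; pose w := 1 - sqrt_poly n : {poly R[i]}.
pose k0 : R[i] := (Num.sqrt a)%:C / a%:C.
(* the polynomial [sqrt a * w] in [coord l], against the resolvent *)
exists (fun l => k0 *: (w.[coord a l] *: (a%:C *: resolvent L l))).
exists (k0 *: (- (two_pi_i R * a%:C) *: poly_op B w)).
split.
- apply: (path_integralZ op_norm_is_ext_norm).
  exact: (circle_integral_resolvent a0 q0 BE B_le w qr).
- have -> : k0 *: (- (two_pi_i R * a%:C) *: poly_op B w) - - two_pi_i R *: T =
      (two_pi_i R * (Num.sqrt a)%:C) *: (P - poly_op B w).
    rewrite /k0 scalerA (_ : _ * - _ = - (two_pi_i R * (Num.sqrt a)%:C)); last by field.
    by rewrite !scaleNr opprK scalerBr addrC /T scalerA.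
  apply: op_norm_le => [|x]; first exact: ltW.
  rewrite !fctE rnormZ rnormM rnormR gtr0_norm//.
  apply: le_trans (ler_wpM2l _ (P_lim n x)) _.
    by rewrite mulr_ge0 ?rnorm_ge0 ?ltW.
  rewrite (mulrAC _ (rnorm x)) !mulrA ler_wpM2r ?rnorm_ge0//.
  by have := Hn2 n (leq_maxr _ _); rewrite /C2 !mulrA.
- move=> x _; set l := circle a rho x.
  have lr : rnorm (coord a l) = rho by exact: rnorm_coord_circle.
  have -> : (gamma l : R[i]) *: resolvent L l -
        k0 *: (w.[coord a l] *: (a%:C *: resolvent L l)) =
      ((a%:C)^-1 * (gamma l - (Num.sqrt a)%:C * w.[coord a l])) *:
        (a%:C *: resolvent L l).
    rewrite /k0 !scalerA -scalerBl; congr (_ *: _).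
    by move: (gamma l) => g; field.
  apply: le_trans (ext_normZ op_norm_is_ext_norm _ (resD _ lr)) _.
  rewrite lee_fin; apply: le_trans (Hn1 n (leq_maxl _ _)).
  rewrite /C1 -[X in _ <= X]mulrAC ler_wpM2r// rnormM rnormV rnormR gtr0_norm//.
  rewrite -[leRHS]mulrA ler_wpM2l ?invr_ge0 ?(ltW a0)//.
  exact: (gamma_approx n a0 s01 rs lr).
Qed.

End SqrtIntegral.

Theorem theorem5p4 (R : realType) (H : completeNormedModType R[i])
    (dot : {dot H for (@Num.conj R[i])})
    (norm_dot : forall x : H, `|x| ^+ 2 = dot x x)
    (L : H -> H) (LGL : GLSplus dot L) :
  exists c : R -> R[i]^o,
    [/\ closed_path c,
        path_image c `<=` @Theta R,
        spectrum L `<=` path_interior c,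
        is_holomorphic_calculus (@Theta R) (@gamma R) L (sqrt_op dot L)
      & is_cauchy_integral (@gamma R) L c (sqrt_op dot L)].
Proof.
have [c [cc cT cL cI]] := GLSplus_sqrt_integral norm_dot LGL.
exists c; split=> //; first by move=> z cz; apply: cT; left.
split; [exact: open_Theta | exact: gamma_holomorphic | | by exists c].
by move=> l /cL cl; apply: cT; right.
Qed.
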